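(* The ring $\Lambda^{[2]}$ is canonically identified with the semigroup algebra over $\mathbb{Q}$ of $\mathrm{Part}^{[2]}$. In particular, $$\Lambda^{[2]}=\mathbb{Q}[p_j(\mu)\mid j>0,\ \mu\in\mathrm{Part}^\star],$$ i.e. $\Lambda^{[2]}$ is freely generated as a polynomial ring by the elements $p_j(\mu)$.
   Context: $\mathrm{Part}$ is the set of generalized integer partitions, i.e. finitely supported functions $\nu:\mathbb{Z}_{\ge0}\to\mathbb{Z}_{\ge0}$, with addition $(\lambda\odot\nu)_i=\lambda_i+\nu_i$; $|\nu|=\sum_ii\nu_i$. $\mathrm{Part}^\star\subset\mathrm{Part}$ is the subset of integer partitions ($\nu_0=0$), also closed under $\odot$. $\mathbb{S}_\nu=\prod_{i\ge0}S_i\wr S_{\nu_i}$, with $S_i\wr S_n=(S_i)^n\rtimes S_n$, $S_0\wr S_n=S_n$; this is the automorphism group of a map of finite sets $f:X\to Y$ having $\nu_i$ fibres of size $i$ for each $i$. $R(\mathbb{S}_\nu)=K_0(\mathrm{Rep}_{\mathbb{S}_\nu})\otimes\mathbb{Q}$ for finite-dimensional representations over $\mathbb{Q}$, equivalently the space of $\mathbb{Q}$-valued class functions on $\mathbb{S}_\nu$. $\Lambda^{[2]}=\bigoplus_{\nu\in\mathrm{Part}}R(\mathbb{S}_\nu)$, with product $R(\mathbb{S}_\lambda)\times R(\mathbb{S}_\nu)\to R(\mathbb{S}_{\lambda\odot\nu})$ given by $V\boxtimes W=\mathrm{Ind}_{\mathbb{S}_\lambda\times\mathbb{S}_\nu}^{\mathbb{S}_{\lambda\odot\nu}}V\otimes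 W$, where $\mathbb{S}_\lambda\times\mathbb{S}_\nu\hookrightarrow\mathbb{S}_{\lambda\odot\nu}$ (well-defined up to conjugacy) is induced by disjoint union of maps of finite sets. A 2-partition is a function $\Theta:\mathrm{Part}^\star\to\mathrm{Part}^\star$ with $\Theta(\mu)=\varnothing$ for $|\mu|\gg0$; $\mathrm{Part}^{[2]}$ is the commutative semigroup of 2-partitions under pointwise addition. For $\tau\in\mathbb{S}_\nu$ viewed as an automorphism of $f:X\to Y$, $\Theta^\tau$ is the 2-partition such that $\Theta^\tau(\mu)$ has one part of size $j$ for each $j$-cycle of $\tau$ on $Y$ such that, for $y$ in the cycle, $\tau^j$ acts on $f^{-1}(y)$ with cycle type $\mu$. The class function associated to a conjugacy class $c$ is normalized so that the class of a representation $V$ of $\mathbb{S}_\nu$ is $\frac1{|\mathbb{S}_\nu|}\sum_\tau\mathrm{Tr}(\tau|V)p_{[\tau]}$ (so $p_{[\tau]}$ takes the value $|C(\tau)|$, the order of the centralizer, on the class of $\tau$ and $0$ elsewhere). The identification matches $p_{[\tau]}$ with $\Theta^\tau\in\mathrm{Part}^{[2]}$. For $j\ge1$ and $\mu\in\mathrm{Part}^\star$, $p_j(\mu)\in R(S_{|\mu|}\wr S_j)\subset\Lambda^{[2]}$ is the element associated to the conjugacy class of $((\sigma,e,\dots,e),\kappa)$ with $\sigma\in S_{|\mu|}$ of cycle type $\mu$ and $\kappa\in S_j$ a $j$-cycle. *)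

(* Defs.v *)
From HB Require Import structures.
From mathcomp Require Import all_boot all_order all_algebra all_fingroup.
From mathcomp Require Import all_field all_character.
From mathcomp Require Import finmap multiset boolp.
From mathcomp.multinomials Require Import monalg.

Set Implicit Arguments.
Unset Strict Implicit.
Unset Printing Implicit Defensive.

Import GRing.Theory Num.Theory.
Import GroupScope.
Local Open Scope fset_scope.
Local Open Scope mset_scope.
Local Open Scope ring_scope.

(* [nu i] is the number of parts of size [i]; parts of size 0 are allowed.
   The operation [\odot] is the multiset sum [`+`]. *)
Definition Part : choiceType := {mset nat}.

Definition psize (nu : Part) : nat := (\sum_(i <- finsupp nu) i * nu i)%N.

Definition PartS : choiceType := {nu : Part | nu 0%N == 0%N}.

Definition pempty : PartS.
Proof. by exists (mset0 : Part); rewrite mset0E. Defined.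

Lemma padd_proof (mu1 mu2 : PartS) :
  (val mu1 `+` val mu2 : Part) 0%N == 0%N.
Proof. by rewrite msetE2 (eqP (valP mu1)) (eqP (valP mu2)). Qed.

Definition padd (mu1 mu2 : PartS) : PartS :=
  exist _ (val mu1 `+` val mu2 : Part) (padd_proof mu1 mu2).

Lemma paddA : associative padd.
Proof. by move=> a b c; apply/val_inj/msetP=> i; rewrite /= !msetE2 addnA. Qed.

Lemma paddC : commutative padd.
Proof. by move=> a b; apply/val_inj/msetP=> i; rewrite /= !msetE2 addnC. Qed.

Lemma padd0 : right_id pempty padd.
Proof. by move=> a; apply/val_inj/msetP=> i; rewrite /= !msetE2 mset0E addn0. Qed.

Lemma padd_eq0 a b : padd a b = pempty -> a = pempty /\ b = pempty.
Proof.
move=> /(congr1 val)/msetP E; split; apply/val_inj/msetP=> i; have := E i;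
  by rewrite /= msetE2 mset0E => /eqP; rewrite addn_eq0 => /andP[/eqP? /eqP?].
Qed.

Record Part2 := MkPart2 {
  part2_fun :> PartS -> PartS;
  part2_bdd : exists N : nat,
    forall mu : PartS, (N <= psize (val mu))%N -> part2_fun mu = pempty
}.

HB.instance Definition _ := gen_eqMixin Part2.
HB.instance Definition _ := gen_choiceMixin Part2.

Lemma part2P (T1 T2 : Part2) : T1 =1 T2 -> T1 = T2.
Proof.
case: T1 T2 => [f Hf] [g Hg] /= /funext E; subst g.
by congr MkPart2; apply: Prop_irrelevance.
Qed.

Definition part2_one : Part2.
Proof. by exists (fun=> pempty); exists 0%N. Defined.

Lemma part2_add_proof (T1 T2 : Part2) : exists N : nat, forall mu : PartS,
  (N <= psize (val mu))%N -> padd (T1 mu) (T2 mu) = pempty.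
Proof.
have [N1 H1] := part2_bdd T1; have [N2 H2] := part2_bdd T2.
exists (maxn N1 N2) => mu; rewrite geq_max => /andP[/H1-> /H2->].
exact: padd0.
Qed.

Definition part2_add (T1 T2 : Part2) : Part2 := MkPart2 (part2_add_proof T1 T2).

Fact part2_addA : associative part2_add.
Proof. by move=> x y z; apply: part2P => mu; apply: paddA. Qed.
Fact part2_addC : commutative part2_add.
Proof. by move=> x y; apply: part2P => mu; apply: paddC. Qed.
Fact part2_addm1 : right_id part2_one part2_add.
Proof. by move=> x; apply: part2P => mu; apply: padd0. Qed.
Fact part2_add1m : left_id part2_one part2_add.
Proof. by move=> x; rewrite part2_addC part2_addm1. Qed.
Fact part2_unitm x y : part2_add x y = part2_one -> x = part2_one /\ y = part2_one.
Proof.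
move=> E; split; apply: part2P => mu;
  by have /padd_eq0[] : padd (x mu) (y mu) = pempty
    by apply: (congr1 (fun T : Part2 => T mu) E).
Qed.

(* [{malg rat[Part2]}] is the semigroup algebra; the law of [Part2], written
   multiplicatively by the library, is pointwise addition. *)
HB.instance Definition _ := Choice_isMonomialDef.Build Part2
  part2_addA part2_add1m part2_addm1 part2_unitm.
HB.instance Definition _ := MonomialDef_isConomialDef.Build Part2 part2_addC.

(* The standard map f : X -> Y with [nu i] fibres of size [i]: the elements of Y
   are the pairs (i, a) with a < nu i, those of X are the ((i, a), b) with
   a < nu i and b < i, and f is the first projection. *)
Definition Yset (nu : Part) : {fset nat * nat} :=
  [fset y in [seq (i, a) | i <- finsupp nu, a <- iota 0 (nu i)]].

Definition Xset (nu : Part) : {fset nat * nat * nat} :=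
  [fset x in [seq (y, b) | y <- Yset nu, b <- iota 0 y.1]].

Lemma in_Yset nu (y : nat * nat) : (y \in Yset nu) = (y.2 < nu y.1)%N.
Proof.
case: y => i a; rewrite !inE /=; apply/allpairsPdep/idP => [|lt_a].
  by case=> i' [a' [_]]; rewrite mem_iota add0n => /andP[_ +] [-> ->].
exists i, a; split=> //; last by rewrite mem_iota.
by rewrite mem_finsupp -lt0n (leq_ltn_trans _ lt_a).
Qed.

Lemma in_Xset nu (x : nat * nat * nat) :
  (x \in Xset nu) = (x.1.2 < nu x.1.1)%N && (x.2 < x.1.1)%N.
Proof.
case: x => y b; rewrite !inE /= -in_Yset; apply/allpairsPdep/andP.
  by case=> y' [b' [Yy]]; rewrite mem_iota add0n => /andP[_ +] [-> ->].
by case=> Yy lt_b; exists y, b; split=> //; rewrite mem_iota.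
Qed.

Definition Yt (nu : Part) : finType := Yset nu.
Definition Xt (nu : Part) : finType := Xset nu.

Lemma fmap_proof nu (x : Xt nu) : (val x).1 \in Yset nu.
Proof. by have := valP x; rewrite in_Xset in_Yset => /andP[]. Qed.

Definition fmap_std nu (x : Xt nu) : Yt nu := [` fmap_proof x].

Section AutMap.
Variables (X Y : finType) (f : X -> Y).

Definition aut_map : {set {perm X} * {perm Y}} :=
  [set s : {perm X} * {perm Y} | [forall x, f (s.1 x) == s.2 (f x)]].

Lemma aut_map_group_set : group_set aut_map.
Proof.
apply/group_setP; split.
  by rewrite inE; apply/forallP=> x; rewrite !perm1.
move=> s t; rewrite !inE => /forallP Hs /forallP Ht; apply/forallP=> x.
by rewrite !permM (eqP (Ht _)) (eqP (Hs _)).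
Qed.

Canonical aut_map_group := Group aut_map_group_set.

End AutMap.

Definition permXY (nu : Part) : finGroupType :=
  ({perm Xt nu} * {perm Yt nu})%type.

(* S_nu = \prod_i S_i wr S_(nu i), realized as the automorphism group of a map
   with [nu i] fibres of size [i]. *)
Definition Sgrp (nu : Part) : {group permXY nu} :=
  aut_map_group (@fmap_std nu).

Section PermExt.
Variables (T1 T2 : finType) (h : T1 -> T2) (h_inj : injective h).

(* [s] on the image of [h], and the identity outside of it. *)
Definition ext_fun (s : {perm T1}) (y : T2) : T2 :=
  if [pick x | h x == y] is Some x then h (s x) else y.

Lemma ext_funE s x : ext_fun s (h x) = h (s x).
Proof.
rewrite /ext_fun; case: pickP => [x' /eqP/h_inj-> //|/(_ x)].
by rewrite eqxx.
Qed.

Lemma ext_fun_out s y : y \notin codom h -> ext_fun s y = y.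
Proof.
rewrite /ext_fun; case: pickP => // x /eqP <-.
by rewrite codom_f.
Qed.

Lemma ext_fun_inj s : injective (ext_fun s).
Proof.
suff K : cancel (ext_fun s) (ext_fun s^-1) by apply: can_inj K.
move=> y; case: (boolP (y \in codom h)) => [/codomP[x ->]|hy].
  by rewrite !ext_funE permK.
by rewrite !ext_fun_out // ext_fun_out.
Qed.

Definition perm_ext (s : {perm T1}) : {perm T2} := perm (ext_fun_inj (s := s)).

Lemma perm_extE s x : perm_ext s (h x) = h (s x).
Proof. by rewrite permE ext_funE. Qed.

Lemma perm_ext_out s y : y \notin codom h -> perm_ext s y = y.
Proof. by move=> hy; rewrite permE ext_fun_out. Qed.

Lemma perm_extM s t : perm_ext (s * t) = (perm_ext s * perm_ext t)%g.
Proof.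
apply/permP=> y; rewrite permM.
case: (boolP (y \in codom h)) => [/codomP[x ->]|hy].
  by rewrite !perm_extE permM.
by rewrite !perm_ext_out.
Qed.

Lemma perm_ext_injective : injective perm_ext.
Proof.
move=> s t E; apply/permP=> x; apply: h_inj.
by rewrite -!perm_extE E.
Qed.

End PermExt.

Section Disjoint.
Variables la nu : Part.

Lemma Yl_proof (y : Yt la) : val y \in Yset (la `+` nu).
Proof.
by have := valP y; rewrite !in_Yset msetE2 => H; apply: ltn_addr.
Qed.
Lemma Yr_proof (y : Yt nu) :
  ((val y).1, (la (val y).1 + (val y).2)%N) \in Yset (la `+` nu).
Proof. by have := valP y; rewrite !in_Yset /= msetE2 ltn_add2l. Qed.
Lemma Xl_proof (x : Xt la) : val x \in Xset (la `+` nu).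
Proof.
by have := valP x; rewrite !in_Xset msetE2 => /andP[H ->]; rewrite ltn_addr.
Qed.
Lemma Xr_proof (x : Xt nu) :
  ((val x).1.1, (la (val x).1.1 + (val x).1.2)%N, (val x).2)
    \in Xset (la `+` nu).
Proof. by have := valP x; rewrite !in_Xset /= msetE2 ltn_add2l. Qed.

Definition Yl (y : Yt la) : Yt (la `+` nu) := [` Yl_proof y].
Definition Yr (y : Yt nu) : Yt (la `+` nu) := [` Yr_proof y].
Definition Xl (x : Xt la) : Xt (la `+` nu) := [` Xl_proof x].
Definition Xr (x : Xt nu) : Xt (la `+` nu) := [` Xr_proof x].

Lemma Yl_inj : injective Yl.
Proof. by move=> y z [/val_inj]. Qed.
Lemma Xl_inj : injective Xl.
Proof. by move=> y z [/val_inj]. Qed.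
Lemma Yr_inj : injective Yr.
Proof.
move=> [[i a] Hy] [[k b] Hz] [/= E1 E2]; apply/val_inj; move: E2.
by rewrite /= E1 => /addnI ->.
Qed.
Lemma Xr_inj : injective Xr.
Proof.
move=> [[[i a] c] Hy] [[[k b] d] Hz] [/= E1 E2 E3]; apply/val_inj; move: E2.
by rewrite /= E1 E3 => /addnI ->.
Qed.

Lemma Ylr y z : Yl y != Yr z.
Proof.
apply/eqP=> /(congr1 val) /= E.
by have := valP y; rewrite in_Yset /= E /= ltnNge leq_addr.
Qed.
Lemma Xlr y z : Xl y != Xr z.
Proof.
apply/eqP=> /(congr1 val) /= E.
by have := valP y; rewrite in_Xset /= E /= ltnNge leq_addr.
Qed.
Lemma Y_cover y : (exists z, y = Yl z) \/ (exists z, y = Yr z).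
Proof.
case: y => [[i a] Hy]; have := Hy; rewrite in_Yset /= msetE2.
case: (ltnP a (la i)) => [lt_a _|le_a].
  have H : (i, a) \in Yset la by rewrite in_Yset.
  by left; exists [` H]; apply/val_inj.
rewrite -{1}(subnKC le_a) ltn_add2l => lt_a.
have H : (i, (a - la i)%N) \in Yset nu by rewrite in_Yset.
by right; exists [` H]; apply/val_inj; rewrite /= subnKC.
Qed.
Lemma X_cover y : (exists z, y = Xl z) \/ (exists z, y = Xr z).
Proof.
case: y => [[[i a] b] Hy]; have := Hy; rewrite in_Xset /= msetE2.
case: (ltnP a (la i)) => [lt_a /andP[_ lt_b]|le_a].
  have H : (i, a, b) \in Xset la by rewrite in_Xset /= lt_a.
  by left; exists [` H]; apply/val_inj.
rewrite -{1}(subnKC le_a) ltn_add2l => lt_a.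
have H : (i, (a - la i)%N, b) \in Xset nu by rewrite in_Xset.
by right; exists [` H]; apply/val_inj; rewrite /= subnKC.
Qed.

Lemma fmap_l x : fmap_std (Xl x) = Yl (fmap_std x).
Proof. exact/val_inj. Qed.
Lemma fmap_r x : fmap_std (Xr x) = Yr (fmap_std x).
Proof. exact/val_inj. Qed.

(* The map of [la `+` nu] is the disjoint union of the maps of [la] and [nu] by
   means of [Xl], [Xr], [Yl] and [Yr]. Any other identification changes this
   embedding S_la x S_nu -> S_(la + nu) by an inner automorphism of the target. *)
Definition emb_fun (g : permXY la * permXY nu) : permXY (la `+` nu) :=
  ((perm_ext Xl_inj g.1.1 * perm_ext Xr_inj g.2.1)%g,
   (perm_ext Yl_inj g.1.2 * perm_ext Yr_inj g.2.2)%g).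

Lemma emb_XlE g x : (emb_fun g).1 (Xl x) = Xl (g.1.1 x).
Proof.
rewrite permM perm_extE perm_ext_out //.
by apply/negP=> /codomP[z /eqP]; rewrite (negPf (Xlr _ _)).
Qed.
Lemma emb_XrE g x : (emb_fun g).1 (Xr x) = Xr (g.2.1 x).
Proof.
rewrite permM (perm_ext_out Xl_inj) ?perm_extE //.
by apply/negP=> /codomP[z /eqP]; rewrite eq_sym (negPf (Xlr _ _)).
Qed.
Lemma emb_YlE g x : (emb_fun g).2 (Yl x) = Yl (g.1.2 x).
Proof.
rewrite permM perm_extE perm_ext_out //.
by apply/negP=> /codomP[z /eqP]; rewrite (negPf (Ylr _ _)).
Qed.
Lemma emb_YrE g x : (emb_fun g).2 (Yr x) = Yr (g.2.2 x).
Proof.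
rewrite permM (perm_ext_out Yl_inj) ?perm_extE //.
by apply/negP=> /codomP[z /eqP]; rewrite eq_sym (negPf (Ylr _ _)).
Qed.

Lemma emb_morph :
  {in setX (Sgrp la) (Sgrp nu) &, {morph emb_fun : g h / (g * h)%g}}.
Proof.
move=> g h _ _; congr (_, _); apply/permP=> z; rewrite [in RHS]permM.
  by case: (X_cover z) => -[x ->]; rewrite ?emb_XlE ?emb_XrE permM.
by case: (Y_cover z) => -[x ->]; rewrite ?emb_YlE ?emb_YrE permM.
Qed.

Canonical emb := Morphism emb_morph.

Lemma emb_injm : 'injm emb.
Proof.
apply/injmP=> g h _ _ E.
have E1 x : (emb_fun g).1 x = (emb_fun h).1 x.
  by have /(congr1 (fun p : permXY _ => p.1 x)) := E.
have E2 x : (emb_fun g).2 x = (emb_fun h).2 x.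
  by have /(congr1 (fun p : permXY _ => p.2 x)) := E.
case: g h E1 E2 {E} => [[g1 g2] [g3 g4]] [[h1 h2] [h3 h4]] E1 E2.
congr ((_, _), (_, _)); apply/permP=> x.
- by apply: Xl_inj; have := E1 (Xl x); rewrite !emb_XlE.
- by apply: Yl_inj; have := E2 (Yl x); rewrite !emb_YlE.
- by apply: Xr_inj; have := E1 (Xr x); rewrite !emb_XrE.
- by apply: Yr_inj; have := E2 (Yr x); rewrite !emb_YrE.
Qed.

Definition emb_im : {group permXY (la `+` nu)} :=
  (emb @* setX (Sgrp la) (Sgrp nu))%G.

Lemma emb_isom : isom (setX (Sgrp la) (Sgrp nu)) emb_im emb.
Proof. by apply/isomP; split; [exact: emb_injm|]. Qed.

Lemma emb_im_sub : emb_im \subset Sgrp (la `+` nu).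
Proof.
apply/subsetP=> _ /morphimP[[g1 g2] _ /setXP[] + + ->].
rewrite !inE => /forallP H1 /forallP H2; apply/forallP=> z.
case: (X_cover z) => -[x ->].
  by rewrite [X in fmap_std X]emb_XlE !fmap_l emb_YlE (eqP (H1 x)).
by rewrite [X in fmap_std X]emb_XrE !fmap_r emb_YrE (eqP (H2 x)).
Qed.

End Disjoint.

Section RatCF.
Variables (gT : finGroupType) (G : {group gT}).

(* R(G) is the Q-vector space of Q-valued class functions on [G], seen inside the
   library's algC-valued class functions. *)
Definition ratcf_pred : {pred 'CF(G)} :=
  fun phi => [forall x, phi x \in Crat].

Fact ratcf_zmod : zmod_closed ratcf_pred.
Proof.
split=> [|phi psi /forallP H1 /forallP H2]; apply/forallP=> x.
  by rewrite cfunE rpred0.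
by rewrite !cfunE rpredB.
Qed.
HB.instance Definition _ := GRing.isZmodClosed.Build _ ratcf_pred ratcf_zmod.

Record ratcf := RatCF {
  ratcf_val :> 'CF(G);
  ratcfP : ratcf_val \in ratcf_pred
}.

HB.instance Definition _ := [isSub for ratcf_val].
HB.instance Definition _ := [Choice of ratcf by <:].
HB.instance Definition _ := [SubChoice_isSubZmodule of ratcf by <:].

Lemma ratcf_rat (phi : ratcf) x : phi x \in Crat.
Proof. by have /forallP := ratcfP phi. Qed.

Fact ratcf_scale_proof (a : rat) (phi : ratcf) :
  ratr a *: (phi : 'CF(G)) \in ratcf_pred.
Proof. by apply/forallP=> x; rewrite cfunE rpredM ?Crat_rat ?ratcf_rat. Qed.
Definition ratcf_scale a phi := RatCF (ratcf_scale_proof a phi).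

Fact ratcf_scaleA a b phi :
  ratcf_scale a (ratcf_scale b phi) = ratcf_scale (a * b) phi.
Proof. by apply: val_inj; rewrite /= scalerA rmorphM. Qed.
Fact ratcf_scale1 : left_id 1 ratcf_scale.
Proof. by move=> phi; apply: val_inj; rewrite /= rmorph1 scale1r. Qed.
Fact ratcf_scaleDr : right_distributive ratcf_scale +%R.
Proof. by move=> a phi psi; apply: val_inj; rewrite /= scalerDr. Qed.
Fact ratcf_scaleDl phi : {morph ratcf_scale^~ phi : a b / a + b}.
Proof. by move=> a b; apply: val_inj; rewrite /= rmorphD scalerDl. Qed.

HB.instance Definition _ := GRing.Zmodule_isLmodule.Build rat ratcf
  ratcf_scaleA ratcf_scale1 ratcf_scaleDr ratcf_scaleDl.

Fact pclass_proof (tau : gT) :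
  #|'C_G[tau]|%:R *: '1_(tau ^: G) \in ratcf_pred.
Proof.
by apply/forallP=> x; rewrite cfunE rpredM ?rpred_nat // cfunElock rpred_nat.
Qed.
(* The class function p_[tau]. *)
Definition pclass (tau : gT) : ratcf := RatCF (pclass_proof tau).

Lemma pclassE tau x : tau \in G -> x \in G ->
  pclass tau x = if x \in tau ^: G then #|'C_G[tau]|%:R else 0.
Proof.
move=> Gtau Gx; rewrite cfunE cfunElock genGid Gx /=.
have -> : (x ^: G \subset tau ^: G) = (x \in tau ^: G).
  apply/idP/idP => [/subsetP-> //|/class_eqP -> //]; exact: class_refl.
by case: ifP; rewrite ?mulr1 ?mulr0.
Qed.

Fact rep_class_proof n (rG : mx_representation rat G n) :
  is_class_fun <<G>>%g [ffun x => ratr (\tr (rG x)) *+ (x \in G) : algC].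
Proof.
rewrite genGid; apply: intro_class_fun => [x y Gx Gy | _ /negbTE-> //].
rewrite groupJr // Gx /conjg !repr_mxM ?groupM ?groupV // mxtrace_mulC.
by rewrite -!repr_mxM ?groupM ?groupV // mulgK.
Qed.

Fact rep_class_rat n (rG : mx_representation rat G n) :
  Cfun 0 (rep_class_proof rG) \in ratcf_pred.
Proof. by apply/forallP=> x; rewrite cfunE rpredMn ?Crat_rat. Qed.

(* The class in R(G) of a representation over Q is its character. *)
Definition rep_class n (rG : mx_representation rat G n) : ratcf :=
  RatCF (rep_class_rat rG).

Lemma rep_classE n (rG : mx_representation rat G n) :
  rep_class rG =
    #|G|%:R^-1 *: \sum_(tau in G) \tr (rG tau) *: pclass tau.
Proof.
apply/val_inj/cfun_inP => x Gx.
have valD (a : rat) (phi : ratcf) : val (a *: phi) = ratr a *: val phi by [].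
have valS (F : gT -> ratcf) :
    val (\sum_(tau in G) F tau) = \sum_(tau in G) val (F tau).
  exact: (big_morph (fun phi : ratcf => val phi)).
rewrite valD [RHS]cfunE valS sum_cfunE fmorphV rmorph_nat.
have E tau : tau \in G -> (val (\tr (rG tau) *: pclass tau)) x =
    if tau \in x ^: G then #|'C_G[x]|%:R * rep_class rG x else 0.
  move=> Gtau; rewrite valD cfunE pclassE // class_sym.
  case: ifP => [xt|_]; last by rewrite mulr0.
  have [y Gy ->] := imsetP xt.
  have Gxy : (x ^ y)%g \in G by rewrite groupJ.
  have -> : rep_class rG x = ratr (\tr (rG (x ^ y)%g)).
    by rewrite -(@cfunJ _ G (rep_class rG) x y Gy) cfunE Gxy mulr1n.
  rewrite mulrC.
  by congr (_%:R * _); rewrite -conjg_set1 normJ -{1}(conjGid Gy) -conjIg cardJg.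
rewrite (eq_bigr _ E) -big_mkcondr /=.
rewrite (eq_bigl (mem (x ^: G))); last first.
  by move=> tau; rewrite andb_idl // => /(subsetP (class_subG Gx (subxx _))).
rewrite big_const iter_addr addr0 -index_cent1 -(Lagrange (subsetIl G 'C[x])).
rewrite -mulrnAl -mulrnA mulrA mulVf ?mul1r // pnatr_eq0 muln_eq0.
by rewrite negb_or -!lt0n cardG_gt0 indexg_gt0.
Qed.

End RatCF.

Section Tensor.
Variables (aT bT : finGroupType) (G : {group aT}) (H : {group bT}).

Fact cfTensor_proof (phi : 'CF(G)) (psi : 'CF(H)) :
  is_class_fun <<setX G H>>%g [ffun z => phi z.1 * psi z.2].
Proof.
rewrite genGid; apply: intro_class_fun => [[x y] [x' y']|[x y]].
  by rewrite !in_setX => _ /andP[Gx' Hy'] /=; rewrite !cfunJ.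
rewrite in_setX negb_and => /orP[/cfun0-> | /cfun0->] /=.
  by rewrite mul0r.
by rewrite mulr0.
Qed.

Definition cfTensor (phi : 'CF(G)) (psi : 'CF(H)) : 'CF(setX G H) :=
  Cfun 0 (cfTensor_proof phi psi).

Lemma cfTensor_rat (phi : ratcf G) (psi : ratcf H) :
  cfTensor phi psi \in @ratcf_pred _ (setX_group G H).
Proof. by apply/forallP=> z; rewrite cfunE rpredM ?ratcf_rat. Qed.

End Tensor.

Lemma cfIsom_rat (aT bT : finGroupType) (G : {group aT})
    (f : {morphism G >-> bT}) (K : {group bT}) (iso : isom G K f)
    (phi : ratcf G) : cfIsom iso phi \in @ratcf_pred _ K.
Proof.
apply/forallP=> z; case: (boolP (z \in K)) => [|/cfun0->]; last exact: rpred0.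
rewrite -{1}(isom_im iso) => /morphimP[x _ Gx ->].
by rewrite cfIsomE ?ratcf_rat.
Qed.

Lemma cfInd_rat (gT : finGroupType) (G K : {group gT}) (phi : ratcf K) :
  K \subset G -> 'Ind[G] phi \in @ratcf_pred _ G.
Proof.
move=> sKG; apply/forallP=> z; rewrite cfIndE // rpredM ?rpredV ?rpred_nat //.
by apply: rpred_sum => y _; apply: ratcf_rat.
Qed.

Definition RS (nu : Part) : lmodType rat := ratcf (Sgrp nu).

Section BoxProd.
Variables (la nu : Part) (phi : RS la) (psi : RS nu).

(* V \boxtimes W, the class function induced along [emb] from V \otimes W. *)
Definition boxprod : RS (la `+` nu) :=
  RatCF (cfInd_rat (RatCF (cfIsom_rat (emb_isom la nu)
           (RatCF (cfTensor_rat phi psi)))) (emb_im_sub la nu)).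

Lemma boxprodE : (boxprod : 'CF(_)) =
  'Ind[Sgrp (la `+` nu)] (cfIsom (emb_isom la nu) (cfTensor phi psi)).
Proof. by []. Qed.

End BoxProd.

(* The direct sum over [Part] of the R(S_nu). *)
Record Lambda2 := MkLambda2 {
  lcomp :> forall nu : Part, RS nu;
  lcomp_fin : exists S : {fset Part}, forall nu, nu \notin S -> lcomp nu = 0
}.

HB.instance Definition _ := gen_eqMixin Lambda2.
HB.instance Definition _ := gen_choiceMixin Lambda2.

Lemma lambda2P (x y : Lambda2) : (forall nu, x nu = y nu) -> x = y.
Proof.
case: x y => [f Hf] [g Hg] /= E.
have {}E : f = g by exact: functional_extensionality_dep.
subst g.
by congr MkLambda2; apply: Prop_irrelevance.
Qed.

Definition lzero : Lambda2.
Proof. by exists (fun=> 0); exists fset0. Defined.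

Lemma lopp_fin (x : Lambda2) :
  exists S : {fset Part}, forall nu, nu \notin S -> - x nu = 0.
Proof. by have [S H] := lcomp_fin x; exists S => nu /H->; rewrite oppr0. Qed.
Definition lopp x := MkLambda2 (lopp_fin x).

Lemma ladd_fin (x y : Lambda2) :
  exists S : {fset Part}, forall nu, nu \notin S -> x nu + y nu = 0.
Proof.
have [S HS] := lcomp_fin x; have [T HT] := lcomp_fin y.
exists (S `|` T)%fset => nu; rewrite in_fsetU negb_or => /andP[/HS-> /HT->].
exact: addr0.
Qed.
Definition ladd x y := MkLambda2 (ladd_fin x y).

Lemma lscale_fin (a : rat) (x : Lambda2) :
  exists S : {fset Part}, forall nu, nu \notin S -> a *: x nu = 0.
Proof. by have [S H] := lcomp_fin x; exists S => nu /H->; rewrite scaler0. Qed.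
Definition lscale a x := MkLambda2 (lscale_fin a x).

Fact laddA : associative ladd.
Proof. by move=> x y z; apply: lambda2P => nu; apply: addrA. Qed.
Fact laddC : commutative ladd.
Proof. by move=> x y; apply: lambda2P => nu; apply: addrC. Qed.
Fact ladd0 : left_id lzero ladd.
Proof. by move=> x; apply: lambda2P => nu; apply: add0r. Qed.
Fact laddN : left_inverse lzero lopp ladd.
Proof. by move=> x; apply: lambda2P => nu; apply: addNr. Qed.
HB.instance Definition _ := GRing.isZmodule.Build Lambda2 laddA laddC ladd0 laddN.

Fact lscaleA a b x : lscale a (lscale b x) = lscale (a * b) x.
Proof. by apply: lambda2P => nu; apply: scalerA. Qed.
Fact lscale1 : left_id 1 lscale.
Proof. by move=> x; apply: lambda2P => nu; apply: scale1r. Qed.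
Fact lscaleDr : right_distributive lscale +%R.
Proof. by move=> a x y; apply: lambda2P => nu; apply: scalerDr. Qed.
Fact lscaleDl x : {morph lscale^~ x : a b / a + b}.
Proof. by move=> a b; apply: lambda2P => nu; apply: scalerDl. Qed.
HB.instance Definition _ := GRing.Zmodule_isLmodule.Build rat Lambda2
  lscaleA lscale1 lscaleDr lscaleDl.

Definition lsupp (x : Lambda2) : {fset Part} :=
  [fset nu in sval (cid (lcomp_fin x)) | x nu != 0].

Lemma mem_lsupp x nu : (nu \in lsupp x) = (x nu != 0).
Proof.
rewrite !inE andb_idl // => xnu; case: cid => S /= HS.
by apply: contraNT xnu => /HS->.
Qed.

Lemma linj_fin nu (phi : RS nu) : exists S : {fset Part},
  forall ka, ka \notin S -> dfwith (fun ka => 0 : RS ka) phi ka = 0.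
Proof. by exists [fset nu] => ka; rewrite in_fset1 => ?; rewrite dfwith_out // eq_sym. Qed.

(* The inclusion of the summand R(S_nu). *)
Definition linj nu (phi : RS nu) : Lambda2 := MkLambda2 (linj_fin phi).

(* The bilinear extension to the direct sum of [boxprod]. *)
Definition lmul (x y : Lambda2) : Lambda2 :=
  \sum_(la <- lsupp x) \sum_(nu <- lsupp y) linj (boxprod (x la) (y nu)).

Fact ratcf1_proof (gT : finGroupType) (G : {group gT}) :
  (1 : 'CF(G)) \in @ratcf_pred _ G.
Proof. by apply/forallP=> x; rewrite cfun1E rpred_nat. Qed.

(* The class of the trivial representation of S_nu for nu = 0. *)
Definition lone : Lambda2 :=
  linj (RatCF (ratcf1_proof (Sgrp mset0)) : RS mset0).

Section CycleType.
Variables (T : finType) (s : {perm T}).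

Lemma cycles_proof (P : pred {set T}) :
  (seq_mset [seq #|c| | c : {set T} in [set c in porbits s | P c]] : Part) 0%N
    == 0%N.
Proof.
rewrite mset_seqE; apply/eqP/count_memPn/mapP => -[c].
rewrite mem_enum inE => /andP[/imsetP[x _ ->] _] /eqP.
by rewrite eq_sym (cardD1 x) porbit_id.
Qed.

(* The multiset of the lengths of the cycles [c] of [s] such that [P c]. *)
Definition cycles (P : pred {set T}) : PartS :=
  exist _ (seq_mset _ : Part) (cycles_proof P).

(* The cycle type of the permutation induced by [s] on an [s]-stable set. *)
Definition cycle_type_on (A : {set T}) : PartS :=
  cycles (fun c => c \subset A).

Definition cycle_type : PartS := cycle_type_on [set: T].

End CycleType.

Section Theta.
Variables (nu : Part) (tau : permXY nu).

Definition fibre (y : Yt nu) : {set Xt nu} :=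
  [set x : Xt nu | fmap_std x == y].

(* For y in a [tau.2]-cycle [c], the power [tau.1 ^+ #|c|] stabilizes the fibre
   of y, and its cycle type there does not depend on the choice of y in [c]. *)
Definition Theta_fun (mu : PartS) : PartS :=
  cycles tau.2 (fun c =>
    [forall y in c, cycle_type_on (tau.1 ^+ #|c|)%g (fibre y) == mu]).

Lemma Theta_proof : exists N : nat,
  forall mu : PartS, (N <= psize (val mu))%N -> Theta_fun mu = pempty.
Proof.
pose ct (y : Yt nu) := cycle_type_on (tau.1 ^+ #|porbit tau.2 y|)%g (fibre y).
exists (\max_y psize (val (ct y))).+1 => mu lt_mu.
apply/val_inj/msetP=> j; rewrite /= mset0E mset_seqE.
apply/count_memPn/mapP => -[c]; rewrite mem_enum inE => /andP[].
move=> /imsetP[y _ ->] /forall_inP /(_ y (porbit_id _ _)) /eqP E _.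
move: lt_mu; rewrite -E ltnNge.
by rewrite (leq_bigmax (F := fun y => psize (val (ct y))) y).
Qed.

Definition Theta : Part2 := MkPart2 Theta_proof.

End Theta.

Lemma cyclesE (T : finType) (s : {perm T}) (P : pred {set T}) k :
  val (cycles s P) k = #|[set c in porbits s | P c && (#|c| == k)]|.
Proof.
rewrite /= mset_seqE count_map -size_filter cardE /enum_mem -filter_predI.
by congr size; apply: eq_filter => c; rewrite /= !inE andbC andbA.
Qed.

Lemma cycle_typeE (T : finType) (s : {perm T}) k :
  val (cycle_type s) k = #|[set c in porbits s | #|c| == k]|.
Proof.
by rewrite cyclesE; apply: eq_card => c; rewrite !inE subsetT.
Qed.

Lemma perm_ext_bij_cycle_type (T1 T2 : finType) (h : T1 -> T2)
    (h_inj : injective h) (s : {perm T1}) : #|T1| = #|T2| ->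
  cycle_type (perm_ext h_inj s) = cycle_type s.
Proof.
move=> eqT; apply/val_inj/msetP => k; rewrite !cycle_typeE.
have extX n x : (perm_ext h_inj s ^+ n)%g (h x) = h ((s ^+ n)%g x).
  by elim: n x => [|n IHn] x; rewrite ?perm1 // !expgSr !permM IHn perm_extE.
have orbE x : porbit (perm_ext h_inj s) (h x) = [set h z | z in porbit s x].
  apply/setP=> y; apply/porbitP/imsetP => [[n ->]|[_ /porbitP[n ->] ->]].
    by exists ((s ^+ n)%g x); [apply/porbitP; exists n|].
  by exists n.
have imh_inj : injective (fun c : {set T1} => [set h z | z in c]).
  exact: imset_inj.
rewrite -(card_imset _ imh_inj); apply: eq_card => c; rewrite inE.
have /(_ _)/codomP hK y : y \in codom h by rewrite inj_card_onto ?eqT.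
apply/andP/imsetP => [[/imsetP[y _ ->]] | [d]].
  have [x ->] := hK y; rewrite orbE (card_imset _ h_inj) => ck.
  by exists (porbit s x); rewrite // inE ck andbT; apply: imset_f.
rewrite inE => /andP[/imsetP[x _ ->] dk] ->; rewrite -orbE; split.
  exact: imset_f.
by rewrite orbE (card_imset _ h_inj).
Qed.

Section Standard.
Variable mu : PartS.
Let nu : Part := val mu.

Lemma card_Xt : #|Xt nu| = psize nu.
Proof.
rewrite -cardfE card_fseq undup_id; last first.
  apply: allpairs_uniq_dep => [|y _|]; [exact: fset_uniq|exact: iota_uniq|].
  by move=> [? ?] [? ?] _ _ /= [-> ->].
rewrite size_allpairs_dep sumnE big_map.
rewrite (perm_big [seq (i, a) | i <- finsupp nu, a <- iota 0 (nu i)]) /=.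
  rewrite big_allpairs_dep /psize; apply: eq_bigr => i _.
  by rewrite (eq_bigr (fun=> i)) ?big_const_seq ?count_predT ?size_iota //=;
    rewrite ?iter_addn ?addn0 // => a _; rewrite size_iota.
apply: uniq_perm; first exact: fset_uniq.
  apply: allpairs_uniq_dep => [|i _|]; [exact: fset_uniq|exact: iota_uniq|].
  by move=> [? ?] [? ?] _ _ /= [-> ->].
by move=> y; rewrite inE.
Qed.

Lemma rotX_proof (x : Xt nu) :
  ((val x).1, ((val x).2.+1 %% (val x).1.1)%N) \in Xset nu.
Proof.
have := valP x; rewrite !in_Xset /= => /andP[-> lt_b].
by rewrite ltn_pmod // (leq_ltn_trans _ lt_b).
Qed.
Definition rotX (x : Xt nu) : Xt nu := [` rotX_proof x].

Lemma iter_rotX n x : val (iter n rotX x) =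
  ((val x).1, (((val x).2 + n) %% (val x).1.1)%N).
Proof.
elim: n => [|n IHn] /=.
  have := valP x; rewrite in_Xset => /andP[_ lt_b].
  by rewrite addn0 modn_small //; case: (val x).
by rewrite [fsval _]IHn /= -addn1 modnDml -addnA addn1.
Qed.

Lemma rotX_inj : injective rotX.
Proof.
suff K (x : Xt nu) : iter (val x).1.1 rotX x = x.
  move=> x y E; have E1 : (val x).1 = (val y).1 by case: (congr1 val E).
  have [k kE] : exists k, (val x).1.1 = k.+1.
    have := valP x; rewrite in_Xset => /andP[_ lt_b].
    by exists (val x).1.1.-1; rewrite prednK // (leq_ltn_trans _ lt_b).
  by rewrite -(K x) -(K y) -E1 kE !iterSr E.
have := valP x; rewrite in_Xset => /andP[_ lt_b].
apply/val_inj; rewrite iter_rotX modnDr modn_small //.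
by case: (val x).
Qed.

Definition std_perm : {perm Xt nu} := perm rotX_inj.

Lemma porbit_std x : porbit std_perm x = fibre (fmap_std x).
Proof.
have itE n z : val ((std_perm ^+ n)%g z) =
    ((val z).1, (((val z).2 + n) %% (val z).1.1)%N).
  rewrite -iter_rotX; congr val; rewrite permX.
  by apply: eq_iter => w; rewrite permE.
apply/setP=> z; rewrite inE; apply/porbitP/eqP => [[n ->]|/(congr1 val) /= E].
  by apply/val_inj; rewrite /= [fsval _]itE.
exists ((val z).2 + (val x).1.1 - (val x).2)%N; apply/val_inj; rewrite itE.
have := valP x; have := valP z; rewrite !in_Xset /= E => /andP[_ lt_z] /andP[_ lt_x].
rewrite subnKC; last by rewrite ltnW // (leq_trans lt_x) ?leq_addl.
by rewrite modnDr modn_small // -E; case: (fsval z).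
Qed.

Lemma card_fibre (y : Yt nu) : #|fibre y| = (val y).1.
Proof.
have H (b : 'I_(val y).1) : (val y, val b) \in Xset nu.
  by have := valP y; rewrite in_Xset in_Yset /= ltn_ord => ->.
pose g b : Xt nu := [` H b].
have g_inj : injective g by move=> b c [/val_inj].
rewrite -[RHS]card_ord -(card_imset _ g_inj); apply: eq_card => x.
rewrite inE; apply/eqP/imsetP => [E|[b _ ->]]; last exact/val_inj.
have := valP x; rewrite in_Xset => /andP[_ lt_b].
have lt_b' : ((val x).2 < (val y).1)%N by rewrite -E.
exists (Ordinal lt_b') => //; apply/val_inj; rewrite /= -E /=.
by case: (fsval x).
Qed.

Lemma card_Yt_part k : #|[set y : Yt nu | (val y).1 == k]| = nu k.
Proof.
have H (a : 'I_(nu k)) : (k, val a) \in Yset nu by rewrite in_Yset /=.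
pose g a : Yt nu := [` H a].
have g_inj : injective g by move=> b c [/val_inj].
rewrite -[RHS]card_ord -(card_imset _ g_inj); apply: eq_card => y.
rewrite inE; apply/eqP/imsetP => [E|[b _ ->]] //.
have := valP y; rewrite in_Yset E => lt_a.
exists (Ordinal lt_a) => //; apply/val_inj; rewrite /= -E /=.
by case: (fsval y).
Qed.

Lemma cycle_type_std : cycle_type std_perm = mu.
Proof.
apply/val_inj/msetP => k; rewrite cycle_typeE.
have [->|k_gt0] := posnP k.
  rewrite (eqP (valP mu)); apply: eq_card0 => c; rewrite inE.
  apply/negP=> /andP[/imsetP[x _ ->]].
  by rewrite (cardD1 x) porbit_id.
rewrite -card_Yt_part -(card_in_imset (f := @fibre nu)).
  apply: eq_card => c; rewrite inE; apply/andP/imsetP.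
    case=> /imsetP[x _ ->]; rewrite porbit_std card_fibre => xk.
    by exists (fmap_std x); rewrite ?inE.
  case=> y; rewrite inE => yk ->; rewrite card_fibre; split=> //.
  have : (0 < #|fibre y|)%N by rewrite card_fibre (eqP yk).
  case/card_gt0P=> x; rewrite inE => /eqP <-; rewrite -porbit_std.
  exact: imset_f.
move=> y z; rewrite !inE => yk _ E.
have : (0 < #|fibre y|)%N by rewrite card_fibre (eqP yk).
case/card_gt0P=> x xy; have := xy; rewrite E inE => /eqP <-.
by move: xy; rewrite inE => /eqP.
Qed.

Lemma cycle_type_exists : exists s : 'S_(psize nu), cycle_type s == mu.
Proof.
pose h (x : Xt nu) : 'I_(psize nu) := cast_ord card_Xt (enum_rank x).
have h_inj : injective h by move=> x y /cast_ord_inj /enum_rank_inj.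
exists (perm_ext h_inj std_perm).
by rewrite perm_ext_bij_cycle_type ?cycle_type_std // card_ord card_Xt.
Qed.

End Standard.

Definition perm_of_type (mu : PartS) : 'S_(psize (val mu)) :=
  xchoose (cycle_type_exists mu).

Lemma perm_of_typeE mu : cycle_type (perm_of_type mu) = mu.
Proof. exact/eqP/(xchooseP (cycle_type_exists mu)). Qed.

(* The j-cycle a -> a + 1 mod j. *)
Definition std_cycle (j : nat) : 'S_j := perm (@ordS_inj j).

(* The wreath product S_m wr S_j is S_nu for nu having j parts of size m. *)
Section Wreath.
Variables (m j : nat).
Let nu : Part := msetn j m.

Lemma hY_proof (a : 'I_j) : (m, val a) \in Yset nu.
Proof. by rewrite in_Yset /= msetnxx. Qed.
Lemma hX_proof (z : 'I_j * 'I_m) : (m, val z.1, val z.2) \in Xset nu.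
Proof. by rewrite in_Xset /= msetnxx !ltn_ord. Qed.

Definition hY (a : 'I_j) : Yt nu := [` hY_proof a].
Definition hX (z : 'I_j * 'I_m) : Xt nu := [` hX_proof z].

Lemma hY_inj : injective hY.
Proof. by move=> a b [/val_inj]. Qed.
Lemma hX_inj : injective hX.
Proof. by move=> [a b] [c d] [/val_inj-> /val_inj->]. Qed.

Variables (sigma : 'S_m) (kappa : 'S_j).

Definition wr_fun (z : 'I_j * 'I_m) : 'I_j * 'I_m :=
  (kappa z.1, if val z.1 == 0%N then sigma z.2 else z.2).

Lemma wr_fun_inj : injective wr_fun.
Proof.
move=> [a b] [c d] [/perm_inj->] /=.
by case: ifP => _ [] => [/perm_inj->|->].
Qed.

(* ((sigma, e, ..., e), kappa) acting on 'I_j * 'I_m over 'I_j. When [kappa] is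
   a j-cycle the conjugacy class does not depend on the coordinate at which
   [sigma] sits. *)
Definition wr_elem : permXY nu :=
  (perm_ext hX_inj (perm wr_fun_inj), perm_ext hY_inj kappa).

Lemma wr_elem_in : wr_elem \in Sgrp nu.
Proof.
rewrite inE; apply/forallP=> -[[[i a] b] Hx].
have := Hx; rewrite in_Xset /= msetnE.
case: eqP => [Ei|] //= /andP[lt_a lt_b]; subst i.
have -> : [` Hx] = hX (Ordinal lt_a, Ordinal lt_b) by apply/val_inj.
have fE z : fmap_std (hX z) = hY z.1 by apply/val_inj.
by rewrite /= !perm_extE !fE perm_extE permE.
Qed.

End Wreath.

(* p_j(mu) *)
Definition p_gen (j : nat) (mu : PartS) : Lambda2 :=
  linj (pclass (Sgrp (msetn j (psize (val mu))))
          (wr_elem (perm_of_type mu) (std_cycle j))).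

(* The polynomial ring Q[p_j(mu) | j > 0, mu], whose monomials are the finitely
   supported exponent functions on the index set of the variables. *)
Definition gen_index : choiceType := ({j : nat | (0 < j)%N} * PartS)%type.
Definition genpoly : comAlgType rat := {malg rat[{cmonom gen_index}]}.
Definition genvar (j : {j : nat | (0 < j)%N}) (mu : PartS) : genpoly :=
  << ucm ((j, mu) : gen_index) >>.

(* Main.v *)
From HB Require Import structures.
Require Import Defs.
From mathcomp Require Import all_boot all_order all_algebra all_fingroup.
From mathcomp Require Import all_field all_character.
From mathcomp Require Import finmap multiset boolp.
From mathcomp.multinomials Require Import monalg.
Import GRing.Theory.

Set Implicit Arguments.
Unset Strict Implicit.
Unset Printing Implicit Defensive.

(** The class functions [p_tau], for [tau] up to conjugacy in some [Sgrp nu], form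
    a basis of [Lambda2]. Three facts about the 2-partition [Theta tau] turn this
    into an isomorphism with the semigroup algebra.

    - [Theta tau] determines [nu] and the conjugacy class of [tau]
      ([Theta_inj_Part], [Theta_conj]). An automorphism of a map f : X -> Y is a
      permutation of X over a permutation of Y. If y lies on a j-cycle, the points
      of X over that cycle are determined up to isomorphism by the j-th power on
      the fibre of y, that is, by its cycle type. Two automorphisms with the same
      2-partition can hence be matched, first on Y and then on X over Y, and the
      result is an isomorphism of maps ([count_type_complete]). Both steps are
      instances of [equivariant_bijection]: two permutations over a common base
      are isomorphic over it when each fibre has equally many points of each
      period. This is also why cycle types appear below as counts of points.

    - Disjoint union adds 2-partitions ([Theta_emb]).

    - Every 2-partition occurs ([Theta_surj]): it is a sum of 2-partitions with a
      single part, and these come from the elements that define the p_j(mu)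
      ([Theta_gen]).

    The isomorphism [Phi] sends a class function phi on [Sgrp nu] to the average of
    [phi tau *: << Theta tau >>] over the group, like the Frobenius characteristic.
    The normalization of [p_tau] makes its image exactly [<< Theta tau >>], and
    Frobenius reciprocity ([average_ind]) makes [Phi] multiplicative, because the
    product of [Lambda2] is an induction along the disjoint union.

    Finally, a 2-partition is a finitely supported family of multiplicities
    indexed by the pairs (j, mu) with j > 0, that is, a monomial in variables with
    these indices ([mon_part2]). So the semigroup algebra is a polynomial ring, and
    the variable (j, mu) is the image of p_j(mu). *)

(** * Cycle lengths of permutations *)

Definition period (T : finType) (s : {perm T}) (x : T) : nat := #|porbit s x|.

Lemma period_gt0 (T : finType) (s : {perm T}) x : (0 < period s x)%N.
Proof. by rewrite lt0n card_porbit_neq0. Qed.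

Lemma period_expg (T : finType) (s : {perm T}) i x :
  period s ((s ^+ i)%g x) = period s x.
Proof. by rewrite /period porbit_perm. Qed.

Lemma expg_period (T : finType) (s : {perm T}) x :
  (s ^+ period s x)%g x = x.
Proof. by rewrite permX iter_porbit. Qed.

Lemma expg_modn_period (T : finType) (s : {perm T}) i x :
  (s ^+ (i %% period s x))%g x = (s ^+ i)%g x.
Proof.
rewrite [in RHS](divn_eq i (period s x)) addnC expgD permM.
rewrite mulnC expgM; set y := (s ^+ (i %% period s x))%g x.
have sy : (s ^+ period s x)%g y = y.
  by rewrite -(period_expg s (i %% period s x)) expg_period.
elim: (i %/ _) => [|k IH]; first by rewrite expg0 perm1.
by rewrite expgS permM sy.
Qed.

Lemma eq_expg_period (T : finType) (s : {perm T}) i k x :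
  ((s ^+ i)%g x == (s ^+ k)%g x) = (i == k %[mod period s x]).
Proof.
rewrite -(expg_modn_period s i) -(expg_modn_period s k).
have nthE m : (m < period s x)%N ->
    (s ^+ m)%g x = nth x (traject s x (period s x)) m.
  by move=> ltm; rewrite nth_traject // permX.
rewrite !nthE ?ltn_mod ?period_gt0 // nth_uniq ?uniq_traject_porbit //;
  by rewrite size_traject ltn_mod period_gt0.
Qed.

Lemma expg_fix_period (T : finType) (s : {perm T}) i x :
  ((s ^+ i)%g x == x) = (period s x %| i)%N.
Proof.
by rewrite -[X in _ == X]perm1 -(expg0 s) eq_expg_period mod0n.
Qed.

(** The period of [x] under [s] is [m] times its period under [s ^+ m] as soon as
    [m] divides it; [s'] stands for any permutation that agrees with [s ^+ m] on
    whether its powers fix the point. *)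
Lemma eq_period_dvd (T T' : finType) (s : {perm T}) (s' : {perm T'}) x x' m :
  (0 < m)%N ->
  (forall i, ((s ^+ (m * i))%g x == x) = ((s' ^+ i)%g x' == x')) ->
  (m %| period s x)%N -> period s x = (m * period s' x')%N.
Proof.
move=> m0 H /dvdnP[q Eq]; apply/eqP; rewrite eqn_dvd.
rewrite -expg_fix_period H expg_fix_period dvdnn /= Eq mulnC dvdn_pmul2r //.
by rewrite -expg_fix_period -H mulnC -Eq expg_period.
Qed.

Lemma expg_equivar (T T' : finType) (s : {perm T}) (s' : {perm T'}) (h : T -> T') :
  (forall x, h (s x) = s' (h x)) ->
  forall i x, h ((s ^+ i)%g x) = (s' ^+ i)%g (h x).
Proof.
move=> H; elim=> [|i IH] x; first by rewrite !expg0 !perm1.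
by rewrite !expgSr !permM H IH.
Qed.

Lemma stable_expg (T : finType) (s : {perm T}) (A : {set T}) :
  (forall x, x \in A -> s x \in A) ->
  forall i x, x \in A -> (s ^+ i)%g x \in A.
Proof.
move=> sA; elim=> [|i IH] x xA; first by rewrite expg0 perm1.
by rewrite expgS permM IH ?sA.
Qed.

Lemma period_inj (T T' : finType) (s : {perm T}) (s' : {perm T'}) (h : T -> T') :
  injective h -> (forall x, h (s x) = s' (h x)) ->
  forall x, period s' (h x) = period s x.
Proof.
move=> hI H x; have := @eq_period_dvd _ _ s' s (h x) x 1%N.
rewrite mul1n dvd1n => -> // i.
by rewrite mul1n -(expg_equivar H) (inj_eq hI).
Qed.

(** Counting points instead of cycles: all later comparisons of cycle types go
    through such counts, which are easy to transport along bijections. *)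
Lemma card_period_cycles (T : finType) (s : {perm T}) (A : {set T}) m :
  (forall x, x \in A -> s x \in A) ->
  #|[set x in A | period s x == m]| =
    (m * #|[set c in porbits s | (c \subset A) && (#|c| == m)]|)%N.
Proof.
move=> sA.
set P := [set c in porbits s | _].
rewrite -sum1_card (partition_big (porbit s) (fun c => c \in P)) /=; last first.
  move=> x; rewrite !inE => /andP[xA ->]; rewrite imset_f // andbT /=.
  by apply/subsetP => y /porbitP[i ->]; apply: stable_expg.
rewrite (eq_bigr (fun=> m)) => [|c]; first by rewrite sum_nat_const mulnC.
rewrite inE => /and3P[/imsetP[x _ ->] cA /eqP cm].
rewrite sum1_card -[RHS]cm; apply: eq_card => y; rewrite unfold_in /= !inE.
rewrite eq_porbit_mem.
apply: andb_idl => yx; rewrite (subsetP cA) //=.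
by rewrite /period; move: yx; rewrite -eq_porbit_mem => /eqP ->; rewrite cm.
Qed.

Lemma cycles_count (T : finType) (s : {perm T}) (A : {set T}) (P : pred {set T}) m :
  (forall x, x \in A -> s x \in A) ->
  (forall x, P (porbit s x) = (porbit s x \subset A)) ->
  (m * val (cycles s P) m)%N = #|[set x in A | period s x == m]|.
Proof.
move=> sA PA; rewrite card_period_cycles // cyclesE; congr (_ * _)%N.
apply: eq_card => c; rewrite !inE; case: imsetP => //= -[x _ ->].
by rewrite PA.
Qed.

(** A partition has no part 0, so the numbers of points [m * mu m] determine it. *)
Lemma PartS_eq (m1 m2 : PartS) :
  (forall m, (m * val m1 m)%N = (m * val m2 m)%N) -> m1 = m2.
Proof.
move=> H; apply/val_inj/msetP => m; have [->|m0] := posnP m.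
  by rewrite (eqP (valP m1)) (eqP (valP m2)).
by have /eqP := H m; rewrite eqn_pmul2l // => /eqP.
Qed.

(** * Matching two permutations over a common base *)

Section Matching.
Variables (X X' : finType) (s : {perm X}) (s' : {perm X'}).

Section OneOrbit.
Variables (x : X) (x' : X').
Hypothesis eq_per : period s x = period s' x'.

(** [s ^+ i] of [x] goes to [s' ^+ i] of [x']; the exponent is read off as the
    position of [z] in the cycle of [x]. *)
Definition orbit_map (z : X) : X' :=
  (s' ^+ index z (traject s x (period s x)))%g x'.

Lemma orbit_mapE i : orbit_map ((s ^+ i)%g x) = (s' ^+ i)%g x'.
Proof.
apply/eqP; rewrite eq_expg_period -eq_per -eq_expg_period; apply/eqP.
set l := traject _ _ _.
have ml : (s ^+ i)%g x \in l by rewrite -porbit_traject mem_porbit.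
have lt_l : (index ((s ^+ i)%g x) l < period s x)%N.
  by rewrite -[leqRHS](size_traject s x) index_mem.
by rewrite -[RHS](nth_index x ml) nth_traject // permX.
Qed.

Lemma card_orbit_map (Q : pred X) (Q' : pred X') :
  (forall i, Q ((s ^+ i)%g x) = Q' ((s' ^+ i)%g x')) ->
  #|[set z in porbit s x | Q z]| = #|[set z in porbit s' x' | Q' z]|.
Proof.
move=> QQ.
rewrite -(@card_in_imset _ _ orbit_map); last first.
  move=> z w; rewrite !inE => /andP[/porbitP[i ->] _] /andP[/porbitP[k ->] _].
  by move/eqP; rewrite !orbit_mapE eq_expg_period -eq_per -eq_expg_period => /eqP.
apply: eq_card => z; rewrite !inE; apply/imsetP/andP.
  case=> y; rewrite inE => /andP[/porbitP[i ->] Qy] ->.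
  by rewrite orbit_mapE mem_porbit -QQ.
case=> /porbitP[i ->] Qz; exists ((s ^+ i)%g x); last by rewrite orbit_mapE.
by rewrite inE mem_porbit QQ.
Qed.

End OneOrbit.

Variables (C : eqType) (t : C -> C) (c : X -> C) (c' : X' -> C).
Hypothesis cs : forall x, c (s x) = t (c x).
Hypothesis cs' : forall x, c' (s' x) = t (c' x).

Lemma base_expg i x : c ((s ^+ i)%g x) = iter i t (c x).
Proof. by elim: i => [|i IH]; rewrite ?expg0 ?perm1 // expgSr permM cs IH. Qed.

Lemma base_expg' i x : c' ((s' ^+ i)%g x) = iter i t (c' x).
Proof. by elim: i => [|i IH]; rewrite ?expg0 ?perm1 // expgSr permM cs' IH. Qed.

(** Induction on a bound [n] for the number of points still to be matched. An
    orbit in [A] and an orbit in [A'] that have the same length and start over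
    the same point of the base meet every fibre in the same number of points, so
    the inequality survives when both are removed. The point [x0] only provides
    values outside [A]. *)
Lemma equivariant_injection_in (x0 : X') n (A : {set X}) (A' : {set X'}) :
  (#|A| <= n)%N ->
  (forall x, x \in A -> s x \in A) -> (forall x, x \in A' -> s' x \in A') ->
  (forall v m, #|[set x in A | (c x == v) && (period s x == m)]|
     <= #|[set x in A' | (c' x == v) && (period s' x == m)]|)%N ->
  exists h : X -> X', [/\ {in A &, injective h},
    (forall x, x \in A -> h x \in A'),
    (forall x, x \in A -> h (s x) = s' (h x)) &
    (forall x, x \in A -> c' (h x) = c x)].
Proof.
elim: n A A' => [|n IH] A A' An sA sA' H.
  have A0 x : x \in A = false.
    by move: An; rewrite leqn0 cards_eq0 => /eqP->; rewrite inE.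
  by exists (fun=> x0); split=> x; rewrite ?A0 // => y; rewrite A0.
have [->|/set0Pn[x xA]] := eqVneq A set0.
  by exists (fun=> x0); split=> x; rewrite ?inE // => y; rewrite inE.
have : (0 < #|[set z in A' | (c' z == c x) && (period s' z == period s x)]|)%N.
  apply: leq_trans (H _ _); apply/card_gt0P; exists x.
  by rewrite inE xA !eqxx.
case/card_gt0P => x'; rewrite inE => /and3P[xA' /eqP cx' /eqP px'].
have sDn (T : finType) (u : {perm T}) (B : {set T}) y :
    (forall x, x \in B -> u x \in B) ->
    forall x, x \in B :\: porbit u y -> u x \in B :\: porbit u y.
  move=> uB z; rewrite !inE => /andP[zy zB]; rewrite uB // andbT.
  by rewrite -eq_porbit_mem -[u z]/((u ^+ 1)%g z) porbit_perm eq_porbit_mem.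
have orbA (T : finType) (u : {perm T}) (B : {set T}) y (Q : pred T) :
    (forall x, x \in B -> u x \in B) -> y \in B ->
    #|[set z in B | Q z]| = (#|[set z in porbit u y | Q z]|
       + #|[set z in B :\: porbit u y | Q z]|)%N.
  move=> uB yB; rewrite -(cardsID (porbit u y) [set z in B | Q z]).
  congr (_ + _)%N; apply: eq_card => z; rewrite !inE; last by rewrite andbA.
  case: (boolP (z \in porbit u y)) => [/porbitP[i ->]|]; rewrite ?andbF //.
  by rewrite stable_expg // andbT.
pose A1 := A :\: porbit s x; pose A1' := A' :\: porbit s' x'.
case: (IH A1 A1').
- rewrite -ltnS; apply: leq_trans An; apply: proper_card.
  by apply/properP; split; [exact: subsetDl | exists x; rewrite // !inE porbit_id].
- exact: sDn.
- exact: sDn.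
- move=> v m; have := H v m.
  rewrite (orbA _ _ _ x _ sA xA) (orbA _ _ _ x' _ sA' xA').
  rewrite (@card_orbit_map x x' _ _
    [pred z | (c' z == v) && (period s' z == m)]) ?leq_add2l // => i.
  by rewrite /= !period_expg base_expg base_expg' cx' px'.
move=> h [hI hA hs hc].
exists (fun z => if z \in porbit s x then orbit_map x x' z else h z).
split=> [z w zA wA|z zA|z zA|z zA].
- case: ifP => [/porbitP[i ->]|zx]; case: ifP => [/porbitP[k ->]|wx].
  + move/eqP; rewrite !orbit_mapE // eq_expg_period px'.
    by rewrite -eq_expg_period => /eqP.
  + rewrite orbit_mapE // => E; have := hA w; rewrite !inE wx wA => /(_ isT).
    by rewrite -E mem_porbit.
  + rewrite orbit_mapE // => E; have := hA z; rewrite !inE zx zA => /(_ isT).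
    by rewrite E mem_porbit.
  + by apply: hI; rewrite !inE ?zx ?wx.
- case: ifP => [/porbitP[i ->]|zx]; first by rewrite orbit_mapE // stable_expg.
  by have := hA z; rewrite !inE zx zA => /(_ isT)/andP[].
- rewrite -eq_porbit_mem -[s z]/((s ^+ 1)%g z) porbit_perm eq_porbit_mem.
  case: ifP => [/porbitP[i ->]|zx].
    by rewrite -permM -expgD addn1 !orbit_mapE // expgSr permM.
  by rewrite expg1 hs // !inE zx.
- case: ifP => [/porbitP[i ->]|zx]; last by rewrite hc // !inE zx.
  by rewrite orbit_mapE // base_expg base_expg' cx'.
Qed.

Lemma equivariant_injection :
  (forall v m, #|[set x | (c x == v) && (period s x == m)]|
     = #|[set x | (c' x == v) && (period s' x == m)]|) ->
  exists h : X -> X', [/\ injective h,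
    (forall x, h (s x) = s' (h x)) & (forall x, c' (h x) = c x)].
Proof.
move=> H; case: (pickP X') => [x0 _|X0].
  have [] := @equivariant_injection_in x0 #|X| setT setT.
  - exact: max_card.
  - by [].
  - by [].
  - by move=> v m; have := H v m; rewrite !setIdE !setTI => ->.
  move=> h [hI _ hs hc]; exists h; split=> [y z|y|y]; first exact: hI.
    by rewrite hs.
  by rewrite hc.
have X'0 : X -> False.
  move=> x; have := H (c x) (period s x).
  rewrite [RHS]eq_card0 => [/eqP|y]; last by have := X0 y.
  by rewrite cards_eq0 => /eqP/setP/(_ x); rewrite !inE !eqxx.
by exists (fun x => False_rect _ (X'0 x)); split=> x; case: (X'0 x).
Qed.

End Matching.

(** Injections both ways make the injection bijective. The base is an arbitrary
    type with a self-map: it is a set of colours fixed by the permutations in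
    one use, and the target of a map, on which they act, in the other. *)
Lemma equivariant_bijection (X X' : finType) (s : {perm X}) (s' : {perm X'})
    (C : eqType) (t : C -> C) (c : X -> C) (c' : X' -> C) :
  (forall x, c (s x) = t (c x)) -> (forall x, c' (s' x) = t (c' x)) ->
  (forall v m, #|[set x | (c x == v) && (period s x == m)]|
     = #|[set x | (c' x == v) && (period s' x == m)]|) ->
  exists h : X -> X', [/\ bijective h,
    (forall x, h (s x) = s' (h x)) & (forall x, c' (h x) = c x)].
Proof.
move=> cs cs' H; have [h [hI hs hc]] := equivariant_injection cs cs' H.
have [g [gI _ _]] := equivariant_injection cs' cs (fun v m => esym (H v m)).
exists h; split=> //; apply: inj_card_bij => //.
exact: leq_card gI.
Qed.

(** * Automorphisms of a map of finite sets *)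

Lemma aut_mapE (X Y : finType) (f : X -> Y) s :
  s \in aut_map f -> forall x, f (s.1 x) = s.2 (f x).
Proof. by rewrite inE => /forallP fs x; apply/eqP. Qed.

Section FibreType.
Variables (X Y : finType) (f : X -> Y) (s : {perm X} * {perm Y}).

Definition fibre_type (y : Y) : PartS :=
  cycle_type_on (s.1 ^+ period s.2 y)%g [set x | f x == y].

(** The count of points that encodes the multiplicity of [j] in the value at [mu]
    of the 2-partition of [s]. *)
Definition count_type (mu : PartS) (j : nat) : nat :=
  #|[set y | (fibre_type y == mu) && (period s.2 y == j)]|.

Hypothesis fs : s \in aut_map f.

Lemma aut_map_expg i x : f ((s.1 ^+ i)%g x) = (s.2 ^+ i)%g (f x).
Proof. by apply: expg_equivar; apply: aut_mapE fs. Qed.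

Lemma fibre_type_count y m : (m * val (fibre_type y) m)%N =
  #|[set x | (f x == y) && (period (s.1 ^+ period s.2 y)%g x == m)]|.
Proof.
rewrite (@cycles_count _ _ [set x | f x == y]) //.
  by apply: eq_card => x; rewrite !inE.
move=> x; rewrite !inE => /eqP fx.
by rewrite aut_map_expg fx expg_period.
Qed.

(** A point returns to its fibre only at multiples of the period of its image. *)
Lemma period_fibre x :
  period s.1 x = (period s.2 (f x) * period (s.1 ^+ period s.2 (f x))%g x)%N.
Proof.
apply: eq_period_dvd (period_gt0 _ _) _ _ => [i|]; first by rewrite expgM.
by rewrite -expg_fix_period -aut_map_expg expg_period.
Qed.

(** Since [period_fibre] relates the periods under [s.1] to those under the return
    map of a fibre, the type of the fibre determines how many of its points have
    a given period under [s.1]. *)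
Lemma card_fibre_period y n :
  #|[set x | (f x == y) && (period s.1 x == n)]| =
    if (period s.2 y %| n)%N
    then (n %/ period s.2 y * val (fibre_type y) (n %/ period s.2 y))%N else 0%N.
Proof.
set j := period s.2 y; have j0 : (0 < j)%N := period_gt0 _ _.
have perE x : f x == y -> period s.1 x = (j * period (s.1 ^+ j)%g x)%N.
  by move/eqP=> fx; rewrite period_fibre fx.
case: ifP => [/dvdnP[q ->]|nj].
  rewrite mulnK // fibre_type_count; apply: eq_card => x; rewrite !inE.
  by case: (boolP (f x == y)) => // /perE ->; rewrite mulnC eqn_pmul2r.
apply: eq_card0 => x; rewrite !inE; apply/negP => /andP[/perE -> /eqP E].
by rewrite -E dvdn_mulr in nj.
Qed.

End FibreType.

(** A morphism of maps that is bijective on fibres preserves fibre types. It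
    covers isomorphisms, the automorphism itself seen as an isomorphism, and the
    two inclusions into a disjoint union. *)
Lemma fibre_type_cartesian (X Y X' Y' : finType) (f : X -> Y) (f' : X' -> Y')
    s s' (h : X -> X') (k : Y -> Y') :
  s \in aut_map f -> s' \in aut_map f' ->
  injective h -> injective k ->
  (forall x, f' (h x) = k (f x)) ->
  (forall x' y, f' x' = k y -> exists x, x' = h x) ->
  (forall x, h (s.1 x) = s'.1 (h x)) -> (forall y, k (s.2 y) = s'.2 (k y)) ->
  forall y, fibre_type f' s' (k y) = fibre_type f s y.
Proof.
move=> fs fs' hI kI fh cart hs ks y; apply: PartS_eq => m.
rewrite !fibre_type_count // -(card_imset _ hI); apply: eq_card => x'.
rewrite (period_inj kI ks); set j := period _ y.
have perE x : period (s'.1 ^+ j)%g (h x) = period (s.1 ^+ j)%g x.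
  by apply: period_inj => // z; apply: expg_equivar.
rewrite inE; apply/andP/imsetP => [[/eqP fx']|[x + ->]].
  have [x Ex] := cart _ _ fx'; rewrite Ex perE => pm; exists x => //.
  by rewrite inE pm andbT -(inj_eq kI) -fh -Ex fx'.
by rewrite inE perE fh (inj_eq kI) => /andP[-> ->].
Qed.

Lemma fibre_type_perm (X Y : finType) (f : X -> Y) s y :
  s \in aut_map f -> fibre_type f s (s.2 y) = fibre_type f s y.
Proof.
move=> fs; apply: (fibre_type_cartesian (h := s.1)) => //; try exact: perm_inj.
  by move=> x; rewrite (aut_mapE fs).
by move=> x' y' _; exists (s.1^-1%g x'); rewrite permKV.
Qed.

Lemma fibre_type_expg (X Y : finType) (f : X -> Y) s i y :
  s \in aut_map f -> fibre_type f s ((s.2 ^+ i)%g y) = fibre_type f s y.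
Proof.
move=> fs; elim: i => [|i IH]; rewrite ?expg0 ?perm1 //.
by rewrite expgSr permM fibre_type_perm.
Qed.

Lemma count_type_iso (X Y X' Y' : finType) (f : X -> Y) (f' : X' -> Y')
    s s' (h : X -> X') (k : Y -> Y') :
  s \in aut_map f -> s' \in aut_map f' ->
  bijective h -> bijective k -> (forall x, f' (h x) = k (f x)) ->
  (forall x, h (s.1 x) = s'.1 (h x)) -> (forall y, k (s.2 y) = s'.2 (k y)) ->
  count_type f s =2 count_type f' s'.
Proof.
move=> fs fs' bh [k' kk' k'k] fh hs ks mu j.
have kI := can_inj kk'; have hI := bij_inj bh.
have typeE := fibre_type_cartesian fs fs' hI kI fh _ hs ks.
rewrite /count_type -(card_imset _ kI); apply: eq_card => y.
rewrite inE -{2 3}(k'k y) (period_inj kI ks) typeE; last first.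
  by move=> x' _ _; case: bh => h' hh' h'h; exists (h' x').
apply/imsetP/idP => [[z + ->]|H]; first by rewrite kk' inE.
by exists (k' y); rewrite ?k'k ?inE.
Qed.

(** Matching twice: first the targets, coloured by fibre type, then the sources
    over the matched target; the counts needed the second time come from
    [card_fibre_period]. *)
Lemma count_type_complete (X Y X' Y' : finType) (f : X -> Y) (f' : X' -> Y') s s' :
  s \in aut_map f -> s' \in aut_map f' ->
  count_type f s =2 count_type f' s' ->
  exists (h : X -> X') (k : Y -> Y'), [/\ bijective h, bijective k,
    (forall x, f' (h x) = k (f x)),
    (forall x, h (s.1 x) = s'.1 (h x)) & (forall y, k (s.2 y) = s'.2 (k y))].
Proof.
move=> fs fs' E.
have [k [bk ks kt]] := @equivariant_bijection _ _ s.2 s'.2 _ id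
  (fibre_type f s) (fibre_type f' s')
  (fun y => fibre_type_perm y fs) (fun y => fibre_type_perm y fs') E.
have kI := bij_inj bk.
have [//|//||h [bh hs hf]] := @equivariant_bijection _ _ s.1 s'.1 _ s'.2 (k \o f) f'.
- by move=> x; rewrite /= (aut_mapE fs) ks.
- exact: aut_mapE fs'.
- move=> v m; have [k' kk' k'k] := bk; rewrite -(k'k v).
  rewrite (card_fibre_period fs') (period_inj kI ks) kt -(card_fibre_period fs).
  by apply: eq_card => x; rewrite !inE (inj_eq kI).
by exists h, k.
Qed.

(** * The 2-partition of an automorphism *)

Lemma Theta_count nu (tau : permXY nu) mu j : tau \in Sgrp nu ->
  (j * val (Theta tau mu) j)%N = count_type (@fmap_std nu) tau mu j.
Proof.
move=> tauG.
rewrite (@cycles_count _ _ [set y | fibre_type (@fmap_std nu) tau y == mu]).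
- by apply: eq_card => y; rewrite !inE.
- by move=> y; rewrite !inE fibre_type_perm.
move=> y; apply/forall_inP/subsetP => H z zy; have := H z zy;
  by rewrite !inE /fibre_type /period; move: zy; rewrite -eq_porbit_mem => /eqP->.
Qed.

Lemma Theta_eq_count nu nu' (tau : permXY nu) (tau' : permXY nu') :
  tau \in Sgrp nu -> tau' \in Sgrp nu' ->
  Theta tau = Theta tau' <->
  count_type (@fmap_std nu) tau =2 count_type (@fmap_std nu') tau'.
Proof.
move=> tG tG'; split=> [E mu j|E]; first by rewrite -!Theta_count // E.
by apply: part2P => mu; apply: PartS_eq => j; rewrite !Theta_count.
Qed.

Lemma card_fibre_std nu (y : Yt nu) : #|[set x | fmap_std x == y]| = (val y).1.
Proof.
have H (b : 'I_(val y).1) : (val y, val b) \in Xset nu.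
  by have := valP y; rewrite in_Xset in_Yset /= ltn_ord => ->.
pose g b : Xt nu := [` H b]%fset.
have g_inj : injective g by move=> b c [/val_inj].
rewrite -[RHS]card_ord -(card_imset _ g_inj); apply: eq_card => x.
rewrite inE; apply/eqP/imsetP => [E|[b _ ->]]; last exact/val_inj.
have := valP x; rewrite in_Xset => /andP[_ lt_b].
have lt_b' : ((val x).2 < (val y).1)%N by rewrite -E.
exists (Ordinal lt_b') => //; apply/val_inj; rewrite /= -E /=.
by case: (fsval x).
Qed.

Lemma card_Y_std (nu : Part) i :
  #|[set y : Yt nu | #|[set x | fmap_std x == y]| == i]| = nu i.
Proof.
have H (a : 'I_(nu i)) : (i, val a) \in Yset nu by rewrite in_Yset /=.
pose g a : Yt nu := [` H a]%fset.
have g_inj : injective g by move=> b c [/val_inj].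
rewrite -[RHS]card_ord -(card_imset _ g_inj); apply: eq_card => y.
rewrite inE card_fibre_std; apply/eqP/imsetP => [E|[b _ ->]] //.
have := valP y; rewrite in_Yset E => lt_a.
exists (Ordinal lt_a) => //; apply/val_inj; rewrite /= -E /=.
by case: (fsval y).
Qed.

(** An isomorphism of maps preserves the sizes of the fibres, and [nu i] counts
    the fibres of size [i]. *)
Lemma Theta_inj_Part nu nu' (tau : permXY nu) (tau' : permXY nu') :
  tau \in Sgrp nu -> tau' \in Sgrp nu' -> Theta tau = Theta tau' -> nu = nu'.
Proof.
move=> tG tG' /(Theta_eq_count tG tG')/(count_type_complete tG tG').
case=> h [k [bh bk fh _ _]]; have kI := bij_inj bk; have [h' hh' h'h] := bh.
have [k' kk' k'k] := bk.
have cardE y : #|[set x | fmap_std x == k y]| = #|[set x | fmap_std x == y]|.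
  rewrite -(card_imset _ (can_inj hh')); apply: eq_card => x.
  rewrite inE; apply/idP/imsetP => [E|[z + ->]].
    by exists (h' x); rewrite ?h'h // inE -(inj_eq kI) -fh h'h.
  by rewrite inE fh (inj_eq kI).
apply/msetP => i; rewrite -!card_Y_std -(card_imset _ kI); apply: eq_card => y.
rewrite inE -{2}(k'k y) cardE; apply/imsetP/idP => [[z + ->]|H].
  by rewrite kk' inE.
by exists (k' y); rewrite ?k'k ?inE.
Qed.

(** An isomorphism between two automorphisms of the same map is an element of its
    automorphism group that conjugates one into the other. *)
Lemma Theta_conj nu (sigma tau : permXY nu) :
  sigma \in Sgrp nu -> tau \in Sgrp nu ->
  Theta sigma = Theta tau <-> sigma \in (tau ^: Sgrp nu)%g.
Proof.
move=> sG tG; rewrite Theta_eq_count //; split.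
  case/(count_type_complete sG tG) => h [k [bh bk fh hs ks]].
  pose g : permXY nu := (perm (bij_inj bh), perm (bij_inj bk)).
  have gG : g \in Sgrp nu by rewrite inE; apply/forallP => x; rewrite !permE fh.
  rewrite class_sym; apply/imsetP; exists g => //.
  rewrite conjgE; apply: (canRL (mulKg g)); congr (_, _); apply/permP => z.
    by rewrite !permM !permE hs.
  by rewrite !permM !permE ks.
case/imsetP => g gG ->.
(* With the convention [x ^ g = g^-1 * x * g], [g^-1] carries [tau ^ g] to [tau]. *)
have kG := groupVr gG.
apply: (@count_type_iso _ _ _ _ _ _ _ _ g^-1.1%g g^-1.2%g) => //.
- by rewrite groupJ.
- by exists g.1 => x /=; rewrite ?permK ?permKV.
- by exists g.2 => x /=; rewrite ?permK ?permKV.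
- by move=> x; rewrite (aut_mapE kG).
- by move=> x; rewrite /= !permM permK.
- by move=> x; rewrite /= !permM permK.
Qed.

(** * Disjoint unions and generators *)

Lemma emb_in la nu (sigma : permXY la) (tau : permXY nu) :
  sigma \in Sgrp la -> tau \in Sgrp nu ->
  emb la nu (sigma, tau) \in Sgrp (msetD la nu).
Proof.
move=> sG tG; apply: (subsetP (emb_im_sub la nu)).
by apply: mem_morphim; rewrite inE /= sG.
Qed.

(** The cycles on a disjoint union are those of the two parts, with the same
    fibres above them. *)
Lemma Theta_emb la nu (sigma : permXY la) (tau : permXY nu) :
  sigma \in Sgrp la -> tau \in Sgrp nu ->
  Theta (emb la nu (sigma, tau)) = part2_add (Theta sigma) (Theta tau).
Proof.
move=> sG tG; have eG := emb_in sG tG; set e := emb _ _ _ in eG *.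
have eXl x : Xl nu (sigma.1 x) = e.1 (Xl nu x) by rewrite [RHS]emb_XlE.
have eYl y : Yl nu (sigma.2 y) = e.2 (Yl nu y) by rewrite [RHS]emb_YlE.
have eXr x : Xr la (tau.1 x) = e.1 (Xr la x) by rewrite [RHS]emb_XrE.
have eYr y : Yr la (tau.2 y) = e.2 (Yr la y) by rewrite [RHS]emb_YrE.
have typel : forall y, fibre_type (@fmap_std _) e (Yl nu y)
    = fibre_type (@fmap_std _) sigma y.
  apply: (fibre_type_cartesian (h := @Xl la nu)) => //; try exact: Xl_inj.
  - exact: Yl_inj.
  - exact: fmap_l.
  - move=> x y; case: (X_cover x) => -[z ->]; first by exists z.
    by rewrite fmap_r => /eqP; rewrite eq_sym (negPf (Ylr _ _)).
have typer : forall y, fibre_type (@fmap_std _) e (Yr la y)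
    = fibre_type (@fmap_std _) tau y.
  apply: (fibre_type_cartesian (h := @Xr la nu)) => //; try exact: Xr_inj.
  - exact: Yr_inj.
  - exact: fmap_r.
  - move=> x y; case: (X_cover x) => -[z ->]; last by exists z.
    by rewrite fmap_l => /eqP; rewrite (negPf (Ylr _ _)).
apply: part2P => mu; apply: PartS_eq => j.
rewrite [val (part2_add _ _ _) j]msetE2 mulnDr !Theta_count //.
rewrite /count_type -(card_imset _ (@Yl_inj la nu)) -(card_imset _ (@Yr_inj la nu)).
rewrite -cardsUI; set I := (_ :&: _); have -> : I = set0.
  apply/setP => y; rewrite !inE; apply/negP => /andP[/imsetP[z _ ->]].
  by case/imsetP => w _ /eqP; rewrite (negPf (Ylr _ _)).
rewrite cards0 addn0; apply: eq_card => y; rewrite !inE; apply/idP/orP.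
  case: (Y_cover y) => -[z ->].
    rewrite typel (period_inj (@Yl_inj _ _) eYl) => H.
    by left; apply: imset_f; rewrite inE.
  rewrite typer (period_inj (@Yr_inj _ _) eYr) => H.
  by right; apply: imset_f; rewrite inE.
case=> /imsetP[z + ->]; rewrite inE.
  by rewrite typel (period_inj (@Yl_inj _ _) eYl).
by rewrite typer (period_inj (@Yr_inj _ _) eYr).
Qed.

Lemma std_cycle_expg j i a : val ((std_cycle j ^+ i)%g a) = ((a + i) %% j)%N.
Proof.
elim: i => [|i IH]; first by rewrite expg0 perm1 addn0 modn_small.
by rewrite expgSr permM permE /= IH -[(_ %% _).+1]addn1 modnDml addn1 addnS.
Qed.

Lemma period_std_cycle j a : period (std_cycle j) a = j.
Proof.
have fixE i : ((std_cycle j ^+ i)%g a == a) = (j %| i)%N.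
  rewrite -val_eqE /= std_cycle_expg -[X in _ == X](modn_small (ltn_ord a)).
  by rewrite -[X in _ == X %[mod _]]addn0 eqn_modDl mod0n.
apply/eqP; rewrite eqn_dvd -expg_fix_period fixE dvdnn.
by rewrite -fixE expg_period eqxx.
Qed.

Section WreathType.
Variables (j : nat) (mu : PartS).
Hypothesis j0 : (0 < j)%N.
Let m := psize (val mu).
Let sigma : 'S_m := perm_of_type mu.
Let w := wr_elem sigma (std_cycle j).
Let a0 : 'I_j := Ordinal j0.

Lemma wr_elem_X z : w.1 (hX z) = hX (std_cycle j z.1,
  if val z.1 == 0%N then sigma z.2 else z.2).
Proof. by rewrite perm_extE permE. Qed.

Lemma wr_elem_Y a : w.2 (hY m a) = hY m (std_cycle j a).
Proof. by rewrite perm_extE. Qed.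

Lemma hY_surj (y : Yt (msetn j m)) : exists a, y = hY m a.
Proof.
case: y => [[i a] Hy]; have := Hy; rewrite in_Yset /= msetnE.
case: eqP => [Ei|//] lt_a; subst i.
by exists (Ordinal lt_a); apply/val_inj.
Qed.

Lemma hX_surj (x : Xt (msetn j m)) : exists z, x = hX z.
Proof.
case: x => [[[i a] b] Hx]; have := Hx; rewrite in_Xset /= msetnE.
case: eqP => [Ei|//] /andP[lt_a lt_b]; subst i.
by exists (Ordinal lt_a, Ordinal lt_b); apply/val_inj.
Qed.

Lemma fmap_hX (z : 'I_j * 'I_m) : fmap_std (hX z) = hY m z.1.
Proof. exact/val_inj. Qed.

Lemma period_wr_Y a : period w.2 (hY m a) = j.
Proof.
rewrite (period_inj (@hY_inj m j) (s := std_cycle j)) ?period_std_cycle //.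
by move=> b; rewrite wr_elem_Y.
Qed.

(** One turn around the cycle applies [sigma] exactly once. *)
Lemma wr_elem_turn b : (w.1 ^+ j)%g (hX (a0, b)) = hX (a0, sigma b).
Proof.
have E i : (0 < i <= j)%N ->
    (w.1 ^+ i)%g (hX (a0, b)) = hX ((std_cycle j ^+ i)%g a0, sigma b).
  case: i => // i; elim: i => [|i IH] ltij.
    by rewrite !expg1 wr_elem_X.
  rewrite expgSr permM IH ?(ltnW ltij) // wr_elem_X [in RHS]expgSr permM.
  by rewrite /= std_cycle_expg add0n modn_small.
rewrite E ?j0 //=; congr (hX (_, _)).
by rewrite -[RHS](expg_period (std_cycle j)) period_std_cycle.
Qed.

(** All points of the target lie on one cycle, so only the fibre over 0 matters. *)
Lemma fibre_type_wr y : fibre_type (@fmap_std _) w y = mu.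
Proof.
have wG : w \in Sgrp (msetn j m) := wr_elem_in _ _.
suff E0 : fibre_type (@fmap_std _) w (hY m a0) = mu.
  have [a ->] := hY_surj y; rewrite -[in RHS]E0 -[RHS](fibre_type_expg a _ wG).
  congr (fibre_type _ _ _).
  rewrite -(expg_equivar (s := std_cycle j)) => [|b]; last by rewrite wr_elem_Y.
  by congr (hY m _); apply/val_inj; rewrite std_cycle_expg add0n modn_small.
apply: PartS_eq => k; rewrite fibre_type_count // period_wr_Y.
rewrite -[in RHS](perm_of_typeE mu) (@cycles_count _ _ [set: 'I_m]) //.
have hI : injective (fun b : 'I_m => hX (a0, b)) by move=> b c /hX_inj[].
have perE b : period (w.1 ^+ j)%g (hX (a0, b)) = period sigma b.
  by apply: (period_inj hI) => c; rewrite wr_elem_turn.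
rewrite -[RHS](card_imset _ hI); apply: eq_card => x; rewrite inE.
have [[a b] ->] := hX_surj x; rewrite fmap_hX (inj_eq (@hY_inj m j)) /=.
apply/andP/imsetP => [[/eqP-> pk]|[c + /hX_inj[-> ->]]].
  by exists b; rewrite // !inE -perE.
by rewrite !inE perE eqxx.
Qed.

(** [wr_elem] of [sigma] and a [j]-cycle has a single cycle on the target. *)
Lemma Theta_wr_elem mu' j' :
  val (Theta w mu') j' = ((j, mu) == (j', mu')) :> nat.
Proof.
have wG : w \in Sgrp (msetn j m) := wr_elem_in _ _.
have [->|j'0] := posnP j'.
  by rewrite (eqP (valP (Theta w mu'))) xpair_eqE gtn_eqF.
apply/eqP; rewrite -(eqn_pmul2l j'0) Theta_count // /count_type.
rewrite xpair_eqE; apply/eqP.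
have -> : [set y | (fibre_type (@fmap_std _) w y == mu') && (period w.2 y == j')]
    = if (j == j') && (mu == mu') then setT else set0.
  apply/setP => y; have [a ->] := hY_surj y; rewrite inE.
  by rewrite fibre_type_wr period_wr_Y andbC; case: ifP; rewrite inE.
case: ifP => [/andP[/eqP<- _]|_]; last by rewrite cards0 muln0.
rewrite muln1 -[RHS]card_ord -(card_imset _ (@hY_inj m j)); apply: eq_card => y.
by rewrite inE; have [a ->] := hY_surj y; rewrite imset_f.
Qed.

End WreathType.

Lemma Theta_mset0 (tau : permXY mset0) : tau \in Sgrp mset0 -> Theta tau = part2_one.
Proof.
move=> tG; apply: part2P => mu; apply: PartS_eq => j.
rewrite Theta_count // [val (part2_one mu) j]mset0E muln0.
by apply: eq_card0 => -[y Hy]; have := Hy; rewrite in_Yset mset0E.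
Qed.

(** * 2-partitions as monomials *)

(** A monomial in the variables indexed by [(j, mu)] is read as the 2-partition
    whose value at [mu] has part [j] with multiplicity the exponent of that
    variable: this is why the semigroup algebra is a polynomial ring. *)
Section MonomialPart2.
Variable m : {cmonom gen_index}.

Definition mon_mset (mu : PartS) : Part :=
  [fsfun j in [fset val p.1 | p in finsupp m]%fset =>
     if insub j is Some j' then m (j', mu) else 0%N].

Lemma mon_msetE mu (j : {j : nat | (0 < j)%N}) : mon_mset mu (val j) = m (j, mu).
Proof.
rewrite fsfunE valK; case: ifP => // /negP nj; apply/esym/eqP.
rewrite cmE_eq0; apply/negP => jm; apply: nj.
by apply/imfsetP; exists (j, mu).
Qed.

Lemma mon_mset0 mu : mon_mset mu 0%N == 0%N.
Proof. by rewrite fsfunE insubF //; case: ifP. Qed.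

Definition mon_part (mu : PartS) : PartS := exist _ (mon_mset mu) (mon_mset0 mu).

Lemma mon_part_bdd : exists N : nat,
  forall mu : PartS, (N <= psize (val mu))%N -> mon_part mu = pempty.
Proof.
exists (\max_(p <- finsupp m) psize (val p.2)).+1 => mu lt_mu.
apply/val_inj/msetP => j; rewrite /= [RHS]mset0E.
have [->|j0] := posnP j; first exact/eqP/mon_mset0.
rewrite (mon_msetE mu (exist _ j j0)); apply/eqP; rewrite cmE_eq0.
apply: contraL lt_mu => jm; rewrite -leqNgt.
exact: (@leq_bigmax_seq _ _ xpredT (fun p : gen_index => psize (val p.2)) _ jm).
Qed.

Definition mon_part2 : Part2 := MkPart2 mon_part_bdd.

End MonomialPart2.

Lemma mon_part2E m mu (j : {j : nat | (0 < j)%N}) :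
  val (mon_part2 m mu) (val j) = m (j, mu).
Proof. exact: mon_msetE. Qed.

Lemma part2_eq (T1 T2 : Part2) :
  (forall mu (j : {j : nat | (0 < j)%N}),
     val (T1 mu) (val j) = val (T2 mu) (val j)) -> T1 = T2.
Proof.
move=> H; apply: part2P => mu; apply: PartS_eq => j.
by have [->//|j0] := posnP j; rewrite (H mu (exist _ j j0)).
Qed.

Lemma mon_part2_1 : mon_part2 mone = part2_one.
Proof. by apply: part2_eq => mu j; rewrite mon_part2E cm1 [RHS]mset0E. Qed.

Lemma mon_part2M m1 m2 :
  mon_part2 (mmul m1 m2) = part2_add (mon_part2 m1) (mon_part2 m2).
Proof.
by apply: part2_eq => mu j; rewrite [RHS]msetE2 !mon_part2E cmM.
Qed.

Lemma mon_part2_inj : injective mon_part2.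
Proof.
move=> m1 m2 E; apply/eqP/cmP => -[j mu].
by rewrite -!mon_part2E E.
Qed.

(** The permutations of the sets with less than [N] elements have finitely many
    cycle types, and every partition is a cycle type. *)
Lemma PartS_finite N : exists S : seq PartS,
  forall mu : PartS, (psize (val mu) < N)%N -> mu \in S.
Proof.
exists (flatten [seq [seq cycle_type s | s <- enum 'S_n] | n <- iota 0 N]).
move=> mu ltN; apply/flatten_mapP; exists (psize (val mu)).
  by rewrite mem_iota.
by rewrite -[X in X \in _]perm_of_typeE map_f ?mem_enum.
Qed.

Lemma mon_part2_surj T : exists m, mon_part2 m = T.
Proof.
have [N TN] := part2_bdd T; have [S SN] := PartS_finite N.
pose J mu : seq {j : nat | (0 < j)%N} := pmap insub (finsupp (val (T mu))).
pose P : {fset gen_index} := [fset p in [seq (j, mu) | mu <- S, j <- J mu]]%fset.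
exists [cmonom val (T p.2) (val p.1) | p in P]%M.
apply: part2_eq => mu j; rewrite mon_part2E cmE fsfunE /=.
case: ifP => // /negP jP; apply/esym/eqP/negPn/negP => Tj; apply: jP.
rewrite inE; apply/allpairsPdep; exists mu, j; split=> //.
  apply: SN; rewrite ltnNge; apply/negP => /TN TE.
  by rewrite TE mset0E in Tj.
by rewrite mem_pmap_sub mem_finsupp.
Qed.

Lemma Theta_gen (j : {j : nat | (0 < j)%N}) mu :
  Theta (wr_elem (perm_of_type mu) (std_cycle (val j))) =
  mon_part2 (ucm ((j, mu) : gen_index)).
Proof.
apply: part2_eq => mu' j'; rewrite mon_part2E ucmE.
by rewrite (Theta_wr_elem mu (valP j)) !xpair_eqE val_eqE.
Qed.

(** By induction on the degree of the monomial: [Theta_emb] realizes products and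
    [Theta_gen] the variables. *)
Lemma Theta_surj (T : Part2) :
  exists x : {nu & permXY nu},
    projT2 x \in Sgrp (projT1 x) /\ Theta (projT2 x) = T.
Proof.
have [m <-] := mon_part2_surj T; elim: {m}_.+1 {-2}m (ltnSn (mdeg m)) => // d IH m.
rewrite ltnS => md; have [/eqP->|] := boolP (m == mone).
  by exists (existT permXY mset0 1%g); rewrite group1 Theta_mset0 ?group1 ?mon_part2_1.
move=> m1; have : finsupp m != fset0.
  apply: contraNneq m1 => m0; apply/cmP => i; rewrite cm1.
  by apply/eqP; rewrite cmE_eq0 m0 inE.
case/fset0Pn => -[j mu] jm.
have Em : m = mmul (ucm ((j, mu) : gen_index)) (divcm m (ucm ((j, mu) : gen_index))).
  apply/eqP/cmP => i; rewrite cmM divcmE ucmE subnKC //.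
  by case: eqP => // <-; rewrite lt0n cmE_neq0.
have [|[nu tau] /= [tG tE]] := IH (divcm m (ucm ((j, mu) : gen_index))).
  by move: md; rewrite {1}Em mdegM mdegU add1n.
exists (existT permXY (msetD (msetn (val j) (psize (val mu))) nu)
  (emb _ _ (wr_elem (perm_of_type mu) (std_cycle (val j)), tau))).
split=> /=; first by apply: emb_in => //; apply: wr_elem_in.
by rewrite (Theta_emb (wr_elem_in _ _) tG) tE Theta_gen -mon_part2M -Em.
Qed.

(** * Rational class functions *)

Local Open Scope ring_scope.

Section RatValue.
Variables (gT : finGroupType) (G : {group gT}).
Implicit Types phi psi : ratcf G.

(** The values of [phi] as rational numbers: scalars of [Lambda2] are in [rat]. *)
Definition qval phi (x : gT) : rat := getCrat (phi x).

Lemma qvalK phi x : ratr (qval phi x) = phi x.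
Proof. by rewrite getCratK // ratcf_rat. Qed.

Lemma qvalP phi x a : phi x = ratr a -> qval phi x = a.
Proof. by rewrite /qval => ->; rewrite ratCK. Qed.

Lemma qval0 x : qval 0 x = 0.
Proof. by apply: qvalP; rewrite cfunE rmorph0. Qed.

Lemma qvalZ a phi x : qval (a *: phi) x = a * qval phi x.
Proof. by apply: qvalP; rewrite cfunE rmorphM /= qvalK. Qed.

Lemma qvalD phi psi x : qval (phi + psi) x = qval phi x + qval psi x.
Proof. by apply: qvalP; rewrite cfunE rmorphD /= !qvalK. Qed.

Lemma qval_notin phi x : x \notin G -> qval phi x = 0.
Proof.
by move=> xG; apply: qvalP; rewrite cfun0 // rmorph0.
Qed.

Lemma qval_pclass tau x : tau \in G -> x \in G ->
  qval (pclass G tau) x = if x \in (tau ^: G)%g then #|('C_G[tau])%g|%:R else 0.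
Proof.
move=> tG xG; apply: qvalP.
by rewrite pclassE //; case: ifP; rewrite ?rmorph_nat ?rmorph0.
Qed.

Lemma ratcf_eq phi psi : (forall x, x \in G -> qval phi x = qval psi x) -> phi = psi.
Proof.
move=> H; apply/val_inj/cfun_inP => x xG.
by rewrite -[LHS]qvalK H // qvalK.
Qed.

Lemma card_class_cent (tau : gT) :
  tau \in G -> #|G| = (#|(tau ^: G)%g| * #|('C_G[tau])%g|)%N.
Proof. by move=> tG; rewrite -index_cent1 mulnC Lagrange ?subsetIl. Qed.

Lemma cardG_rat_neq0 : #|G|%:R != 0 :> rat.
Proof. by rewrite Num.Theory.pnatr_eq0 -lt0n cardG_gt0. Qed.

(** Averaging [F] against [p_tau] evaluates [F] at the class of [tau]: this is
    what the normalization of [p_tau] is for. *)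
Lemma average_pclass (V : lmodType rat) (F : gT -> V) tau : tau \in G ->
  (forall x, x \in (tau ^: G)%g -> F x = F tau) ->
  #|G|%:R^-1 *: \sum_(x in G) qval (pclass G tau) x *: F x = F tau.
Proof.
move=> tG FJ.
have E x : x \in G -> qval (pclass G tau) x *: F x =
    if x \in (tau ^: G)%g then #|('C_G[tau])%g|%:R *: F tau else 0.
  by move=> xG; rewrite qval_pclass //; case: ifP => [/FJ ->|]; rewrite ?scale0r.
rewrite (eq_bigr _ E) -big_mkcondr /= (eq_bigl (mem (tau ^: G)%g)); last first.
  by move=> x; rewrite andb_idl // => /(subsetP (class_subG tG (subxx _))).
rewrite big_const iter_addr addr0 scalerMnl -mulrnA scalerA.
by rewrite mulnC -card_class_cent // mulVf ?scale1r ?cardG_rat_neq0.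
Qed.

(** The [p_tau] span the class functions: this expansion is the averaging formula
    [average_pclass] applied to [phi] itself, the matrix of values of the [p_tau]
    being symmetric. *)
Lemma ratcf_average phi : phi = #|G|%:R^-1 *: \sum_(x in G) qval phi x *: pclass G x.
Proof.
apply: ratcf_eq => y yG.
rewrite qvalZ (big_morph (fun f => qval f y) (id1 := 0) (op1 := +%R)) ?qval0 //;
  last by move=> f g; apply: qvalD.
have E x : x \in G -> qval (qval phi x *: pclass G x) y =
    qval (pclass G y) x *: (qval phi x : rat^o).
  move=> xG; rewrite qvalZ !qval_pclass // class_sym mulrC.
  case: ifP => [/imsetP[z zG ->]|]; last by rewrite mul0r scale0r.
  by congr (_%:R * _); rewrite -conjg_set1 normJ -{1}(conjGid zG) -conjIg cardJg.
rewrite (eq_bigr _ E); apply/esym.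
apply: (average_pclass (V := rat^o) (F := fun x => qval phi x : rat^o)) => // x.
by case/imsetP => z zG ->; rewrite /qval cfunJ.
Qed.

End RatValue.

(** Frobenius reciprocity, with a class function [F] on [G] that takes values in
    an arbitrary vector space. *)
Lemma average_ind (gT : finGroupType) (G K : {group gT}) (phi : ratcf K)
    (ind : ratcf G) (V : lmodType rat) (F : gT -> V) :
  K \subset G -> ind = 'Ind[G] phi :> 'CF(G) ->
  {in G &, forall x y, F (x ^ y)%g = F x} ->
  #|G|%:R^-1 *: \sum_(x in G) qval ind x *: F x
    = #|K|%:R^-1 *: \sum_(x in K) qval phi x *: F x.
Proof.
move=> sKG indE FJ.
have qind x : qval ind x = #|K|%:R^-1 * \sum_(y in G) qval phi (x ^ y)%g.
  apply: qvalP; rewrite indE cfIndE // rmorphM fmorphV rmorph_nat rmorph_sum /=.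
  by congr (_ * _); apply: eq_bigr => y _; rewrite qvalK.
under eq_bigr => x xG do rewrite qind -scalerA scaler_suml.
rewrite -scaler_sumr exchange_big /=.
have E y : y \in G ->
    \sum_(x in G) qval phi (x ^ y)%g *: F x = \sum_(x in K) qval phi x *: F x.
  move=> yG; rewrite [LHS](eq_bigr (fun x => qval phi (x ^ y)%g *: F (x ^ y)%g)).
    rewrite (reindex_inj (conjg_inj y^-1%g)) /=.
    under eq_bigl => x do rewrite groupJr ?groupV //.
    under eq_bigr => x _ do rewrite conjgKV.
    rewrite (big_setID K) /= [X in _ + X]big1 => [|x]; last first.
      by rewrite inE => /andP[xK _]; rewrite qval_notin // scale0r.
    by rewrite addr0 (setIidPr sKG).
  by move=> x xG; rewrite FJ.
rewrite (eq_bigr _ E) sumr_const -scaler_nat !scalerA.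
by rewrite mulrCA mulVf ?mulr1 ?cardG_rat_neq0.
Qed.

(** * The characteristic map *)

(** The analogue of the Frobenius characteristic of the symmetric groups, with
    the 2-partition of an automorphism in place of a cycle type. *)
Definition ch nu (phi : RS nu) : {malg rat[Part2]} :=
  #|Sgrp nu|%:R^-1 *: \sum_(tau in Sgrp nu) qval phi tau *: << Theta tau >>.

Lemma ch_linear nu a (phi psi : RS nu) : ch (a *: phi + psi) = a *: ch phi + ch psi.
Proof.
rewrite /ch scalerA mulrC -scalerA -scalerDr; congr (_ *: _).
rewrite scaler_sumr -big_split; apply: eq_bigr => tau _ /=.
by rewrite qvalD qvalZ scalerDl scalerA.
Qed.

Lemma Theta_J nu : {in Sgrp nu &, forall x y, Theta (x ^ y)%g = Theta x}.
Proof.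
move=> x y xG yG; apply/Theta_conj => //; first by rewrite groupJ.
exact: imset_f.
Qed.

Lemma ch_pclass nu tau : tau \in Sgrp nu -> ch (pclass (Sgrp nu) tau) = << Theta tau >>.
Proof.
move=> tG; rewrite /ch (average_pclass (F := fun x => << Theta x >>)) // => x.
by case/imsetP => y yG ->; rewrite Theta_J.
Qed.

Lemma malgMU (K : monomType) (a b : K) :
  (<< a >> : {malg rat[K]}) * << b >> = << mmul a b >>.
Proof. by rewrite [LHS]malgM_def fgmulUU mulr1. Qed.

(** Reciprocity along the embedding reduces the average over the larger group to
    one over the product, where [Theta_emb] splits each term. *)
Lemma ch_boxprod la nu (phi : RS la) (psi : RS nu) :
  ch (boxprod phi psi) = ch phi * ch psi.
Proof.
rewrite /ch (average_ind (K := emb_im la nu)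
  (phi := RatCF (cfIsom_rat (emb_isom la nu) (RatCF (cfTensor_rat phi psi))))
  (F := fun x => << Theta x >>)) //; last 2 first.
- exact: emb_im_sub.
- by move=> x y xG yG; rewrite Theta_J.
rewrite card_injm ?emb_injm // cardsX natrM invfM.
rewrite -scalerAl -scalerAr scalerA; congr (_ *: _).
have -> : (emb_im la nu : {set _}) = emb la nu @: setX (Sgrp la) (Sgrp nu).
  exact: morphimEdom.
rewrite big_imset /=; last by apply/injmP; apply: emb_injm.
rewrite mulr_suml.
under [RHS]eq_bigr => x _ do rewrite mulr_sumr.
rewrite pair_big /=; apply: eq_big => [z|[x y] /setXP[xG yG]].
  by case: z => x y; rewrite in_setX.
rewrite [Theta _]Theta_emb // -[<< part2_add _ _ >>]malgMU.
rewrite -scalerAl -scalerAr scalerA; congr (_ *: _).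
apply: qvalP; rewrite rmorphM /= !qvalK.
by rewrite cfIsomE ?cfunE // in_setX xG.
Qed.

(** * The direct sum *)

Lemma lcomp_sum (I : Type) (r : seq I) (F : I -> Lambda2) nu :
  (\sum_(i <- r) F i) nu = \sum_(i <- r) F i nu.
Proof. exact: (big_morph (fun x : Lambda2 => x nu)). Qed.

Lemma linj_in nu (phi : RS nu) : linj phi nu = phi.
Proof. exact: dfwith_in. Qed.

Lemma linj_out nu (phi : RS nu) ka : nu != ka -> linj phi ka = 0.
Proof. by move=> ne; apply: dfwith_out. Qed.

Lemma linj_linear nu a (phi psi : RS nu) :
  linj (a *: phi + psi) = a *: linj phi + linj psi.
Proof.
apply: lambda2P => ka; rewrite -[RHS]/(a *: linj phi ka + linj psi ka).
have [<-|ne] := eqVneq nu ka; first by rewrite !linj_in.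
by rewrite !linj_out // scaler0 addr0.
Qed.
HB.instance Definition _ nu :=
  GRing.isLinear.Build rat (RS nu) Lambda2 *:%R (@linj nu) (@linj_linear nu).

Lemma lambda2_sum (x : Lambda2) : x = \sum_(nu <- lsupp x) linj (x nu).
Proof.
apply: lambda2P => ka; rewrite lcomp_sum.
have [kax|kax] := boolP (ka \in lsupp x); last first.
  rewrite big_seq big1 => [|nu nux].
    by apply/eqP; rewrite mem_lsupp negbK in kax.
  by rewrite linj_out //; apply: contraNneq kax => <-.
rewrite (bigD1_seq ka) ?fset_uniq // linj_in big1 => [|nu ne].
  exact/esym/addr0.
by rewrite linj_out.
Qed.

Definition Phi (x : Lambda2) : {malg rat[Part2]} := \sum_(nu <- lsupp x) ch (x nu).

Lemma ch0 nu : ch (0 : RS nu) = 0.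
Proof. by have := ch_linear (-1) (0 : RS nu) 0; rewrite scaler0 add0r scaleN1r addNr. Qed.

Lemma PhiEw (S : {fset Part}) x : (lsupp x `<=` S)%fset ->
  Phi x = \sum_(nu <- S) ch (x nu).
Proof.
move=> sub; apply: big_fset_incl => // nu _.
by rewrite mem_lsupp negbK => /eqP ->; rewrite ch0.
Qed.

Lemma Phi_linear : linear Phi.
Proof.
move=> a x y.
pose S := (lsupp x `|` lsupp y `|` lsupp (a *: x + y)%R)%fset.
have xS : (lsupp x `<=` S)%fset by rewrite /S -fsetUA fsubsetUl.
have yS : (lsupp y `<=` S)%fset by rewrite /S fsetUAC fsubsetUr.
rewrite (PhiEw xS) (PhiEw yS) (PhiEw (fsubsetUr _ _ : (_ `<=` S)%fset)).
rewrite scaler_sumr -big_split; apply: eq_bigr => nu _.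
exact: (ch_linear a (x nu) (y nu)).
Qed.
HB.instance Definition _ :=
  GRing.isLinear.Build rat Lambda2 {malg rat[Part2]} *:%R Phi Phi_linear.

Lemma Phi_linj nu (phi : RS nu) : Phi (linj phi) = ch phi.
Proof.
rewrite (@PhiEw [fset nu]%fset) ?big_seq_fset1 ?linj_in //.
apply/fsubsetP => ka; rewrite mem_lsupp inE; apply: contraNT => ne.
by rewrite linj_out // eq_sym.
Qed.

Lemma Phi_lmul x y : Phi (lmul x y) = Phi x * Phi y.
Proof.
rewrite raddf_sum mulr_suml; apply: eq_bigr => la _.
rewrite raddf_sum mulr_sumr; apply: eq_bigr => nu _.
by rewrite [LHS]Phi_linj ch_boxprod.
Qed.

Lemma Phi_lone : Phi lone = 1.
Proof.
rewrite Phi_linj /ch.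
rewrite (eq_bigr (fun=> << part2_one >>)) => [|tau tG].
  by rewrite sumr_const -scaler_nat scalerA mulVf ?scale1r ?cardG_rat_neq0.
rewrite Theta_mset0 // [qval _ _](_ : _ = 1) ?scale1r //.
by apply: qvalP; rewrite rmorph1 cfun1E tG.
Qed.

(** * Linear maps out of a free module *)

Section MalgLift.
Variables (K : choiceType) (V : lmodType rat) (B : K -> V).

Definition malg_lift (g : {malg rat[K]}) : V := \sum_(k <- msupp g) g@_k *: B k.

Lemma malg_liftEw (S : {fset K}) g : (msupp g `<=` S)%fset ->
  malg_lift g = \sum_(k <- S) g@_k *: B k.
Proof.
move=> sub; apply: big_fset_incl => // k _ /mcoeff_outdom ->.
by rewrite scale0r.
Qed.

Lemma malg_lift_linear : linear malg_lift.
Proof.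
move=> a x y.
pose S := (msupp x `|` msupp y `|` msupp (a *: x + y)%R)%fset.
have xS : (msupp x `<=` S)%fset by rewrite /S -fsetUA fsubsetUl.
have yS : (msupp y `<=` S)%fset by rewrite /S fsetUAC fsubsetUr.
rewrite (malg_liftEw xS) (malg_liftEw yS) (malg_liftEw (fsubsetUr _ _ : (_ `<=` S)%fset)).
rewrite scaler_sumr -big_split; apply: eq_bigr => k _ /=.
by rewrite mcoeffD mcoeffZ scalerDl scalerA.
Qed.
HB.instance Definition _ :=
  GRing.isLinear.Build rat {malg rat[K]} V *:%R malg_lift malg_lift_linear.

Lemma malg_liftU k : malg_lift << k >> = B k.
Proof.
rewrite (@malg_liftEw [fset k]%fset) ?msuppU_le // big_seq_fset1.
by rewrite mcoeffUU scale1r.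
Qed.

End MalgLift.

Lemma malgUZ (K : choiceType) (c : rat) (k : K) :
  << c *g k >> = c *: << k >> :> {malg rat[K]}.
Proof. by apply/malgP => l; rewrite mcoeffZ !mcoeffU mulr_natr. Qed.

Lemma malg_linear_ext (K : choiceType) (V : lmodType rat)
    (F G : {linear {malg rat[K]} -> V}) :
  (forall k, F << k >> = G << k >>) -> F =1 G.
Proof.
move=> H g; rewrite [g]monalgE !raddf_sum; apply: eq_bigr => k _.
by rewrite malgUZ /= !linearZ /= H.
Qed.

Lemma malg_lift_morph (K1 K2 : conomType) (h : K1 -> K2) :
  {morph h : a b / mmul a b} ->
  {morph malg_lift (fun k => << h k >> : {malg rat[K2]}) : f g / f * g}.
Proof.
move=> hM f g; rewrite malgME raddf_sum /= {2 3}/malg_lift mulr_suml.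
apply: eq_bigr => k _; rewrite raddf_sum mulr_sumr; apply: eq_bigr => l _ /=.
by rewrite malgUZ /= linearZ /= malg_liftU hM -malgMU -scalerAl -scalerAr scalerA.
Qed.

(** * The two isomorphisms *)

(** The class function of any automorphism whose 2-partition is [T]. *)
Definition p_Theta (T : Part2) : Lambda2 :=
  let x := projT1 (cid (Theta_surj T)) in linj (pclass (Sgrp (projT1 x)) (projT2 x)).

Lemma Phi_pclass nu tau :
  tau \in Sgrp nu -> Phi (linj (pclass (Sgrp nu) tau)) = << Theta tau >>.
Proof. by move=> tG; rewrite Phi_linj ch_pclass. Qed.

Lemma Phi_p_Theta T : Phi (p_Theta T) = << T >>.
Proof.
rewrite /p_Theta; case: (cid _) => -[nu tau] /= [tG tE].
by rewrite Phi_pclass // tE.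
Qed.

Lemma pclass_conj (gT : finGroupType) (G : {group gT}) (x y : gT) :
  x \in G -> y \in (x ^: G)%g -> pclass G y = pclass G x.
Proof.
move=> xG yx; have yG : y \in G := subsetP (class_subG xG (subxx _)) y yx.
apply/val_inj; rewrite /= (class_eqP yx); congr (_%:R *: _).
have [z zG ->] := imsetP yx.
by rewrite -conjg_set1 normJ -{1}(conjGid zG) -conjIg cardJg.
Qed.

(** [Theta] determines both the group and the conjugacy class, so the choice made
    in [p_Theta] is immaterial. *)
Lemma p_ThetaE nu tau : tau \in Sgrp nu ->
  p_Theta (Theta tau) = linj (pclass (Sgrp nu) tau).
Proof.
move=> tG; rewrite /p_Theta; case: (cid _) => -[nu' tau'] /= [tG' tE].
have Enu := Theta_inj_Part tG' tG tE; subst nu'.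
by congr (linj _); apply: (pclass_conj tG); apply/(Theta_conj tG' tG).
Qed.

Lemma Phi_lift (K : choiceType) (B : K -> Part2) g :
  Phi (malg_lift (p_Theta \o B) g) = malg_lift (fun k => << B k >>) g.
Proof.
rewrite {1}/malg_lift raddf_sum; apply: eq_bigr => k _.
by rewrite /= linearZ /= Phi_p_Theta.
Qed.

Lemma malg_lift_id (K : choiceType) (g : {malg rat[K]}) :
  malg_lift (fun k => << k >>) g = g.
Proof. by apply: (@malg_linear_ext _ _ (malg_lift _) idfun) => k; apply: malg_liftU. Qed.

Lemma PhiK : cancel Phi (malg_lift p_Theta).
Proof.
move=> x; rewrite [in RHS](lambda2_sum x) raddf_sum; apply: eq_bigr => nu _.
rewrite [in RHS](ratcf_average (x nu)) /ch /= !linearZ /=; congr (_ *: _).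
rewrite !raddf_sum; apply: eq_bigr => tau tG.
by rewrite /= !linearZ /= malg_liftU p_ThetaE.
Qed.

Lemma PhiVK : cancel (malg_lift p_Theta) Phi.
Proof. by move=> g; rewrite (Phi_lift id) malg_lift_id. Qed.

(** [Psi] is the inverse of [Phi] after renaming monomials as 2-partitions; as
    [Phi] is injective, its properties are checked after applying [Phi]. *)
Definition Psi : genpoly -> Lambda2 := malg_lift (p_Theta \o mon_part2).
HB.instance Definition _ := GRing.Linear.copy Psi (malg_lift (p_Theta \o mon_part2)).

Theorem theorem2p21 :
  (exists Phi : {linear Lambda2 -> {malg rat[Part2]}},
    [/\ bijective Phi,
        Phi lone = 1,
        {morph Phi : x y / lmul x y >-> x * y}
      & forall (nu : Part) (tau : permXY nu), tau \in Sgrp nu ->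
          Phi (linj (pclass (Sgrp nu) tau)) = << Theta tau >>]) /\
  (exists Psi : {linear genpoly -> Lambda2},
    [/\ bijective Psi,
        Psi 1 = lone,
        {morph Psi : f g / f * g >-> lmul f g}
      & forall (j : {j : nat | (0 < j)%N}) (mu : PartS),
          Psi (genvar j mu) = p_gen (val j) mu]).
Proof.
have PsiU m : Phi (Psi << m >>) = << mon_part2 m >> by rewrite Phi_lift malg_liftU.
split.
  exists Phi; split.
  - by exists (malg_lift p_Theta); [apply: PhiK | apply: PhiVK].
  - exact: Phi_lone.
  - exact: Phi_lmul.
  - exact: Phi_pclass.
have Phi_inj := can_inj PhiK.
exists Psi; split.
- have [g gK] : {g : Part2 -> {cmonom gen_index} | cancel g mon_part2}.
    exists (fun T => projT1 (cid (mon_part2_surj T))) => T.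
    by case: (cid _).
  have Kg := inj_can_sym gK mon_part2_inj.
  exists (malg_lift (fun T => << g T >>) \o Phi) => x /=.
    rewrite Phi_lift; move: x; apply: (@malg_linear_ext _ _
      (malg_lift (fun T => << g T >>) \o malg_lift (fun m => << mon_part2 m >>)) idfun).
    by move=> m /=; rewrite !malg_liftU Kg.
  apply: Phi_inj; rewrite Phi_lift; move: (Phi x); apply: (@malg_linear_ext _ _
      (malg_lift (fun m => << mon_part2 m >>) \o malg_lift (fun T => << g T >>)) idfun).
  by move=> T /=; rewrite !malg_liftU gK.
- by apply: Phi_inj; rewrite Phi_lone [LHS]PsiU mon_part2_1.
- move=> f g; apply: Phi_inj; rewrite Phi_lmul !Phi_lift.
  by rewrite malg_lift_morph //; apply: mon_part2M.
- move=> j mu; apply: Phi_inj; rewrite [LHS]PsiU [RHS]Phi_pclass ?wr_elem_in //.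
  by rewrite Theta_gen.
Qed.
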